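(* Let $\mathfrak{C}$ be a typical circuit class that contains $\mathsf{AC}^0[p]$ for some fixed prime $p$. Let $k\ge1$ and $\delta\in(0,1)$ be fixed. For every Boolean function $f\in\mathfrak{C}[n^k]$ there exists $c=c(k,\delta)\in\mathbb{N}$ such that $(1/2-\Omega(1/n^c))$-approximating $f$ $\mathsf{AC}^0$-reduces via $tt$-reductions to $\mathsf{MCSP}$-$\mathfrak{C}[2^{n/2}]$, as well as to any property with density at least $1/4$ that is useful against $\mathfrak{C}[2^{\delta n}]$.
   Context: A circuit class is typical if it is one of $\mathsf{AC}^0$, $\mathsf{AC}^0[p]$, $\mathsf{ACC}^0$, $\mathsf{TC}^0$, $\mathsf{NC}^1$, $\mathsf{Formula}$, $\mathsf{Circuit}$; $\mathfrak{C}[s(n)]$ denotes $n$-variable $\mathfrak{C}$-circuits with at most $s(n)$ wires, and a language/function family $f=\{f_n\}$ is in $\mathfrak{C}[s]$ if $f_n$ has such a circuit for all large $n$. For $y\in\{0,1\}^{2^n}$, $\mathtt{fn}(y)$ is the $n$-bit Boolean function with truth table $y$. $\mathsf{MCSP}$-$\mathfrak{C}[s]$: given $y\in\{0,1\}^{2^n}$ (other inputs rejected), decide whether $\mathtt{fn}(y)$ has $\mathfrak{C}$-circuits of size at most $s(n)$. A combinatorial property $\mathfrak{R}=\{\mathcal{R}_n\}$ ($\mathcal{R}_n$ a set of $n$-bit Boolean functions, viewed as the language $L_{\mathfrak{R}}$ of their truth tables) has density at least $1/4$ if $\Pr_{g}[g\in\mathcal{R}_n]\ge1/4$ for uniformly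 random $g$ and large $n$, and is useful against $\mathfrak{C}[s]$ if $\mathcal{R}_n$ contains no function in $\mathfrak{C}[s(n)]$ for large $n$. Reductions: $L$ $\mathfrak{D}$-reduces to $L'$ via $tt$-reductions if there is a (non-uniform) sequence of polynomial-size oracle $\mathfrak{D}$-circuits, with all oracle gates at the same level and no directed path from one oracle gate to another, computing $L\cap\{0,1\}^n$ when the oracle gates compute $L'$. For $\varepsilon\colon\mathbb{N}\to[0,1]$, ''$\varepsilon$-approximating $L$ reduces to $L'$'' means there is a language $\tilde L$ agreeing with $L$ on at least a $1-\varepsilon(n)$ fraction of inputs of length $n$ for all large $n$ such that $\tilde L$ reduces to $L'$. *)

(* Defs.v *)
From mathcomp Require Import all_boot all_order all_algebra.
From mathcomp Require Import boolp classical_sets filter reals topology exp.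

Set Implicit Arguments.
Unset Strict Implicit.
Unset Printing Implicit Defensive.

Import Order.TTheory GRing.Theory Num.Theory.
Local Open Scope classical_set_scope.
Local Open Scope nat_scope.

(* A language; its n-th slice is the Boolean function x : n.-tuple bool => L x. *)
Definition language := seq bool -> bool.

(* Circuits are DAGs presented in topological order.  In an n-input circuit,
   node j < n is the j-th input and node n + i is the i-th gate.  The list
   [args] may repeat a node (parallel wires).  The constants are the AND and
   the OR of no arguments. *)

Inductive gate_kind :=
  | GAnd | GOr | GNot | GMod of nat | GMaj | GOracle.

Record gate := Gate { kind : gate_kind; args : seq nat }.

Record circuit := Circ { gates : seq gate; output : nat }.

Definition is_oracle (k : gate_kind) : bool := if k is GOracle then true else false.

(* Labels all nodes from left to right; f labels a gate given the labels of its
   arguments.  The default x0 is never used in a well-formed circuit. *)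
Definition propagate (T : Type) (x0 : T) (f : gate_kind -> seq T -> T)
    (inputs : seq T) (gs : seq gate) : seq T :=
  foldl (fun vs g => rcons vs (f (kind g) [seq nth x0 vs j | j <- args g]))
        inputs gs.

(* MOD_q accepts iff the number of ones is divisible by q; MAJ is unweighted
   majority, ties being accepted. *)
Definition gate_sem (O : language) (k : gate_kind) (vs : seq bool) : bool :=
  match k with
  | GAnd => all id vs
  | GOr => has id vs
  | GNot => ~~ head false vs
  | GMod q => q %| count id vs
  | GMaj => size vs <= (count id vs).*2
  | GOracle => O vs
  end.

Definition eval (O : language) (c : circuit) (x : seq bool) : bool :=
  nth false (propagate false (gate_sem O) x (gates c)) (output c).

Definition wf_circuit (n : nat) (c : circuit) : bool :=
  [forall i : 'I_(size (gates c)),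
     all (fun j => j < n + i) (args (nth (Gate GAnd [::]) (gates c) i))]
  && (output c < n + size (gates c)).

Definition wires (c : circuit) : nat := \sum_(g <- gates c) size (args g).

(* The level of a node: the length of a longest path ending there. *)
Definition levels (n : nat) (c : circuit) : seq nat :=
  propagate 0 (fun _ ds => \max_(d <- ds) d.+1) (nseq n 0) (gates c).

Definition depth (n : nat) (c : circuit) : nat := nth 0 (levels n c) (output c).

(* Whether a path starting at some oracle gate (possibly the empty path) ends
   at a given node. *)
Definition above_oracle (n : nat) (c : circuit) : seq bool :=
  propagate false (fun k bs => is_oracle k || has id bs) (nseq n false) (gates c).

Definition nonadaptive (n : nat) (c : circuit) : bool :=
  constant [seq nth 0 (levels n c) (n + i)
           | i <- iota 0 (size (gates c))
           & is_oracle (kind (nth (Gate GAnd [::]) (gates c) i))]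
  && all (fun g => is_oracle (kind g) ==>
            all (fun j => ~~ nth false (above_oracle n c) j) (args g))
         (gates c).

(* Every gate feeds at most one wire; input nodes may be read repeatedly. *)
Definition fanout_one (n : nat) (c : circuit) : bool :=
  [forall i : 'I_(size (gates c)),
     count_mem (n + i) (flatten [seq args g | g <- gates c]) <= 1].

(* [NC1 a] is the class NC1[s] of circuits with s wires and depth at most
   a * log2 s; a = 1 is the convention "size s and depth log s". *)
Inductive circuit_class :=
  | AC0 | AC0p of nat | ACC0 | TC0 | NC1 of nat | Formula | Circuit.

Definition typical (C : circuit_class) : bool :=
  match C with
  | AC0p q => prime q
  | NC1 a => 0 < a
  | _ => true
  end.

(* The constants hidden in "constant depth" (AC0, AC0[p], ACC0, TC0) and in
   "modular gates of constant modulus" (ACC0).  The other classes ignore them. *)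
Record consts := Consts { depth_bound : nat; modulus_bound : nat }.

Definition le_consts (u v : consts) : bool :=
  (depth_bound u <= depth_bound v) && (modulus_bound u <= modulus_bound v).

Definition unbounded_fanin (C : circuit_class) : bool :=
  match C with
  | AC0 | AC0p _ | ACC0 | TC0 => true
  | NC1 _ | Formula | Circuit => false
  end.

Definition gate_allowed (C : circuit_class) (u : consts) (g : gate) : bool :=
  match kind g with
  | GAnd | GOr => unbounded_fanin C || (size (args g) <= 2)
  | GNot => size (args g) == 1
  | GMod q => match C with
              | AC0p p => q == p
              | ACC0 => 1 < q <= modulus_bound u
              | _ => false
              end
  | GMaj => if C is TC0 then true else false
  | GOracle => false
  end.

Definition shape_ok (C : circuit_class) (u : consts) (n s : nat) (c : circuit) : bool :=
  match C with
  | AC0 | AC0p _ | ACC0 | TC0 => depth n c <= depth_bound u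
  | NC1 a => 2 ^ depth n c <= s ^ a
  | Formula => fanout_one n c
  | Circuit => true
  end.

(* n-input oracle C-circuits with at most s wires. *)
Definition oracle_circuit_of (C : circuit_class) (u : consts) (n s : nat)
    (c : circuit) : bool :=
  [&& wf_circuit n c, wires c <= s, shape_ok C u n s c
    & all (fun g => is_oracle (kind g) || gate_allowed C u g) (gates c)].

Definition circuit_of (C : circuit_class) (u : consts) (n s : nat)
    (c : circuit) : bool :=
  oracle_circuit_of C u n s c && all (fun g => ~~ is_oracle (kind g)) (gates c).

(* f has a C-circuit with at most s wires (the oracle pred0 is irrelevant). *)
Definition has_circuit (C : circuit_class) (u : consts) (n s : nat)
    (f : n.-tuple bool -> bool) : Prop :=
  exists c : circuit,
    circuit_of C u n s c /\ forall x : n.-tuple bool, eval pred0 c x = f x.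

(* L is in C[s], with the hidden constants u. *)
Definition in_class (C : circuit_class) (u : consts) (s : nat -> nat)
    (L : language) : Prop :=
  \forall n \near \oo, has_circuit C u (s n) (fun x : n.-tuple bool => L x).

Definition in_class_poly (C : circuit_class) (L : language) : Prop :=
  exists (u : consts) (k : nat), in_class C u (fun n => n ^ k) L.

Definition class_contains (C D : circuit_class) : Prop :=
  forall L : language, in_class_poly D L -> in_class_poly C L.

(* Position of x in the lexicographic order on {0,1}^n. *)
Definition bin_val (x : seq bool) : nat := foldl (fun m (b : bool) => m.*2 + b) 0 x.

(* The Boolean function with truth table y, for y of length 2^n. *)
Definition fn (n : nat) (y : seq bool) : {ffun n.-tuple bool -> bool} :=
  [ffun x : n.-tuple bool => nth false y (bin_val x)].

Definition MCSP (C : circuit_class) (u : consts) (s : nat -> nat) : language :=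
  fun y => `[< exists n, size y = 2 ^ n /\ has_circuit C u (s n) (fn n y) >].

Definition property := forall n : nat, {pred {ffun n.-tuple bool -> bool}}.

Definition property_language (P : property) : language :=
  fun y => `[< exists n, size y = 2 ^ n /\ fn n y \in P n >].

Definition density_ge_quarter (P : property) : Prop :=
  \forall n \near \oo,
    (1 / 4 <= #|P n|%:R / #|{: {ffun n.-tuple bool -> bool}}|%:R :> rat)%R.

Definition useful_against (C : circuit_class) (u : consts) (s : nat -> nat)
    (P : property) : Prop :=
  \forall n \near \oo, forall g : {ffun n.-tuple bool -> bool},
    g \in P n -> ~ has_circuit C u (s n) g.

Definition tt_reduces (D : circuit_class) (L L' : language) : Prop :=
  exists (u : consts) (e : nat), forall n : nat, exists c : circuit,
    [/\ oracle_circuit_of D u n (n ^ e + e) c, nonadaptive n c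
      & forall x : n.-tuple bool, eval L' c x = L x].

Definition approximates (R : realType) (eps : nat -> R) (L1 L : language) : Prop :=
  \forall n \near \oo,
    (1 - eps n <= #|[pred x : n.-tuple bool | L1 x == L x]|%:R
                  / #|{: n.-tuple bool}|%:R)%R.

Definition approx_tt_reduces (R : realType) (D : circuit_class) (eps : nat -> R)
    (L L' : language) : Prop :=
  exists L1 : language, approximates eps L1 L /\ tt_reduces D L1 L'.

(* The size bound 2^(delta n); wires being counted by integers, rounding it
   down changes nothing. *)
Definition exp_size (R : realType) (delta : R) (n : nat) : nat :=
  Num.truncn (2 `^ (delta * n%:R))%R.

(* Main.v *)
Require Import Defs.
From mathcomp Require Import all_boot all_order all_algebra.
From mathcomp Require Import boolp classical_sets filter reals topology exp.
From mathcomp Require Import finfield zify lra ring.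

Set Implicit Arguments.
Unset Strict Implicit.
Unset Printing Implicit Defensive.

(** Nisan-Wigderson with the Reed-Solomon design, applied to f itself.  Fix a
    constant d with delta d >= k + 8 and d >= 2 (k + 8), let q = 2^r be the power
    of two with n <= q < 2 n, and let l = d r.  A word x of length l encodes a
    polynomial p_x of degree < d over GF(q), and S_x = {(a, p_x(a)) : a < n}; two
    distinct sets meet in fewer than d points.  For a seed z, the function
    x |-> f(z|S_x) on l bits is computed by a circuit for f fed with n small
    formulas for the address p_x(a): in characteristic two, each bit of p_x(a) is
    the XOR of d functions of r bits.  The cost is poly(q) times n^k with an
    exponent independent of d, hence at most q^(k+8) <= 2^(delta l), within the
    same class and with a constant increase of the depth (an increase of O(log n)
    for bounded fan-in).

    A property useful against this size rejects every output of the generator but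
    accepts a quarter of all functions.  A hybrid argument over the 2^l = O(n^d)
    output bits gives a predictor of f with advantage 1/(4 * 2^l); once the seed
    outside S_{x0} and the random bits are fixed, it makes one oracle query, each
    bit of which depends on fewer than d bits of the input.  For MCSP, apply this
    to the functions without circuits of size 2^(l/2), which are the majority by
    counting, and negate the oracle. *)

(** * Formulas compiled into circuits *)

Definition fan_in (gs : seq gate) : seq nat := flatten [seq args g | g <- gs].

Section Propagate.
Variables (T : Type) (x0 : T) (f : gate_kind -> seq T -> T).

Lemma size_propagate vs gs : size (propagate x0 f vs gs) = size vs + size gs.
Proof.
elim: gs vs => [|g gs IH] vs /=; first by rewrite addn0.
by rewrite -[LHS]/(size (propagate _ _ (rcons _ _) gs)) IH size_rcons addSnnS.
Qed.

Lemma propagate_cat vs gs gs' :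
  propagate x0 f vs (gs ++ gs') = propagate x0 f (propagate x0 f vs gs) gs'.
Proof. exact: foldl_cat. Qed.

Lemma propagate_rcons vs gs g :
  propagate x0 f vs (rcons gs g) = rcons (propagate x0 f vs gs)
    (f (kind g) [seq nth x0 (propagate x0 f vs gs) j | j <- args g]).
Proof. exact: foldl_rcons. Qed.

Lemma nth_propagate vs gs j :
  j < size vs -> nth x0 (propagate x0 f vs gs) j = nth x0 vs j.
Proof.
elim/last_ind: gs => [//|gs g IH] lt_j.
by rewrite propagate_rcons nth_rcons size_propagate ltn_addr // IH.
Qed.

Lemma nth_propagate_last vs gs g :
  nth x0 (propagate x0 f vs (rcons gs g)) (size vs + size gs) =
  f (kind g) [seq nth x0 (propagate x0 f vs gs) j | j <- args g].
Proof. by rewrite propagate_rcons nth_rcons size_propagate ltnn eqxx. Qed.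

End Propagate.

(** The base [b] counts every node already present, inputs and earlier gates alike, so that
    well-formedness is stable under concatenation. *)
Definition wf_gates (b : nat) (gs : seq gate) : Prop :=
  forall i, i < size gs ->
    all (fun j => j < b + i) (args (nth (Gate GAnd [::]) gs i)).

Lemma wf_gates_cat b gs gs' :
  wf_gates b gs -> wf_gates (b + size gs) gs' -> wf_gates b (gs ++ gs').
Proof.
move=> wf1 wf2 i; rewrite size_cat nth_cat.
case: (ltnP i (size gs)) => [lt_i _|le_i lt_i]; first exact: (wf1 _ lt_i).
have := wf2 (i - size gs); rewrite ltn_subLR // => /(_ lt_i).
by rewrite -addnA subnKC.
Qed.

Lemma wf_gates_rcons b gs g :
  wf_gates b (rcons gs g) <->
  wf_gates b gs /\ all (fun j => j < b + size gs) (args g).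
Proof.
split=> [wf|[wf1 wf2]].
  split=> [i lt_i|].
    by have := wf i; rewrite size_rcons nth_rcons lt_i ltnS ltnW // => ->.
  by have := wf (size gs); rewrite size_rcons nth_rcons ltnn eqxx ltnS leqnn => ->.
rewrite -cats1; apply: wf_gates_cat => // -[|//] _.
by rewrite addn0.
Qed.

Lemma fan_in_wf b gs : wf_gates b gs -> all (fun j => j < b + size gs) (fan_in gs).
Proof.
elim/last_ind: gs => [//|gs g IH] /wf_gates_rcons [/IH wf1 wf2].
rewrite /fan_in map_rcons flatten_rcons all_cat size_rcons addnS.
by apply/andP; split; [apply: sub_all wf1|apply: sub_all wf2] => j; exact: leqW.
Qed.

(** Formulas; [Leaf j] points to a node that already exists in the circuit. *)
Inductive tree := Leaf of nat | Node of gate_kind & seq tree.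

Section TreeInd.
Variable P : tree -> Prop.
Hypothesis PLeaf : forall j, P (Leaf j).
Hypothesis PNode : forall k ts, List.Forall P ts -> P (Node k ts).

Fixpoint tree_all_ind (t : tree) : P t :=
  match t with
  | Leaf j => PLeaf j
  | Node k ts => @PNode k ts
      ((fix F ts : List.Forall P ts :=
         if ts is t :: ts' then @List.Forall_cons _ _ t _ (tree_all_ind t) (F ts')
         else @List.Forall_nil _ P) ts)
  end.
End TreeInd.

Fixpoint tree_label (T : Type) (f : gate_kind -> seq T -> T) (leaf : nat -> T)
    (t : tree) : T :=
  match t with
  | Leaf j => leaf j
  | Node k ts => f k (map (tree_label f leaf) ts)
  end.

Fixpoint leaves t :=
  match t with Leaf j => [:: j] | Node _ ts => flatten (map leaves ts) end.

Fixpoint tree_wires t :=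
  match t with Leaf _ => 0 | Node _ ts => size ts + sumn (map tree_wires ts) end.

Fixpoint tree_all (p : gate_kind -> nat -> bool) t :=
  match t with
  | Leaf _ => true
  | Node k ts => p k (size ts) && all (tree_all p) ts
  end.

Definition gates_all (p : gate_kind -> nat -> bool) : seq gate -> bool :=
  all (fun g => p (kind g) (size (args g))).

Definition wire_count (gs : seq gate) : nat := sumn [seq size (args g) | g <- gs].

Definition level_op (_ : gate_kind) (ds : seq nat) : nat := \max_(d <- ds) d.+1.

(** The labelling clause is polymorphic, so that one compilation yields truth values, levels and the
    presence of oracle ancestors. The fan-out clause counts the roots as if already read: a new gate
    listed as a root has no reader yet. *)
Record forest_spec (b : nat) (ts : seq tree) (gs : seq gate) (rs : seq nat) : Prop :=
  ForestSpec {
    forest_wf : wf_gates b gs;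
    forest_roots : all (fun r => r < b + size gs) rs;
    forest_label : forall T (x0 : T) f vs, size vs = b ->
      [seq nth x0 (propagate x0 f vs gs) r | r <- rs] =
      [seq tree_label f (nth x0 vs) t | t <- ts];
    forest_wires : wire_count gs = sumn (map tree_wires ts);
    forest_all : forall p, gates_all p gs = all (tree_all p) ts;
    forest_fan : forall x, count_mem x (fan_in gs ++ rs) <=
      if x < b then count_mem x (flatten (map leaves ts)) else 1 }.

Record tree_spec (b : nat) (t : tree) (gs : seq gate) (r : nat) : Prop :=
  TreeSpec {
    tree_forest : forest_spec b [:: t] gs [:: r];
    tree_root : if t is Node _ _ then b <= r else true }.

Lemma fan_in_cat gs gs' : fan_in (gs ++ gs') = fan_in gs ++ fan_in gs'.
Proof. by rewrite /fan_in map_cat flatten_cat. Qed.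

Lemma fan_in_rcons gs g : fan_in (rcons gs g) = fan_in gs ++ args g.
Proof. by rewrite /fan_in map_rcons flatten_rcons. Qed.

Lemma count_mem0 (x : nat) (s : seq nat) (p : pred nat) :
  all p s -> ~~ p x -> count_mem x s = 0.
Proof. by move=> /allP ps npx; apply/count_memPn; apply: contra npx => /ps. Qed.

Lemma forest_nil b : forest_spec b [::] [::] [::].
Proof. by split=> // x; case: ifP. Qed.

Lemma tree_label_ext T (f : gate_kind -> seq T -> T) leaf leaf' t :
  {in leaves t, leaf =1 leaf'} -> tree_label f leaf t = tree_label f leaf' t.
Proof.
elim/tree_all_ind: t => [j|k ts] /=; first by apply; rewrite mem_head.
move=> IH eqf; congr (f k _); elim: IH eqf => //= t {}ts IHt _ IHts eqf.
congr cons; [apply: IHt|apply: IHts] => j jt; apply: eqf;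
  by rewrite mem_cat jt ?orbT.
Qed.

Lemma forest_cons b t ts g1 r1 g2 rs :
  all (fun j => j < b) (leaves t) ->
  all (fun j => j < b) (flatten (map leaves ts)) ->
  tree_spec b t g1 r1 -> forest_spec (b + size g1) ts g2 rs ->
  forest_spec b (t :: ts) (g1 ++ g2) (r1 :: rs).
Proof.
move=> ltt ltts [[wf1 ro1 lab1 wi1 al1 fan1] _] [wf2 ro2 lab2 wi2 al2 fan2].
split.
- exact: wf_gates_cat.
- move: ro1; rewrite /= andbT size_cat addnA => ro1.
  by rewrite ro2 andbT (leq_trans ro1) // leq_addr.
- move=> T x0 f vs sz_vs; rewrite propagate_cat /=.
  have [lab1'] := lab1 T x0 f vs sz_vs.
  rewrite lab2 ?size_propagate ?sz_vs // nth_propagate; last first.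
    by move: ro1; rewrite size_propagate sz_vs /= andbT.
  rewrite lab1'; congr cons.
  elim: ts ltts {lab2 wi2 al2 fan2} => //= u us IH; rewrite all_cat => /andP[ltu ltus].
  rewrite IH //; congr cons; apply: tree_label_ext => j /(allP ltu) ltj.
  by rewrite nth_propagate // sz_vs.
- by rewrite /wire_count map_cat sumn_cat -/(wire_count g1) -/(wire_count g2) wi1 wi2 /= addn0.
- by move=> p; rewrite /gates_all all_cat -!/(gates_all _ _) al1 al2 /= andbT.
- move=> x; have := fan1 x; have := fan2 x.
  rewrite fan_in_cat /= !count_cat /= !addn0.
  case: (ltnP x b) => [lt_xb|le_bx].
    by rewrite ltn_addr //; lia.
  case: ltnP => [lt_x|le_x].
    by rewrite (count_mem0 ltts) ?ltnNge -?leqNgt //; lia.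
  move=> c2 _; rewrite (count_mem0 (x := x) (fan_in_wf wf1)) -?leqNgt //.
  move: ro1; rewrite /= andbT => ro1; have -> : (r1 == x) = false by lia.
  lia.
Qed.

(** Post-order: the arguments are compiled first and their gate is appended last, using up the
    single free wire of each newly created argument root. *)
Lemma tree_compile b t :
  all (fun j => j < b) (leaves t) -> exists gs r, tree_spec b t gs r.
Proof.
elim/tree_all_ind: t b => [j|k ts IH] b /=.
  rewrite andbT => lt_jb; exists [::], j; split=> //; split=> //=.
  - by rewrite addn0 lt_jb.
  - by move=> x; case: ltnP => // le_bx; rewrite addn0; lia.
move=> lt_ts.
suff [gs [rs [wf ro lab wi al fan]]] : exists gs rs, forest_spec b ts gs rs.
  have rs_n : size rs = size ts.
    have := lab bool false (fun _ _ => false) (nseq b false) (size_nseq _ _).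
    by move/(congr1 size); rewrite !size_map.
  exists (rcons gs (Gate k rs)), (b + size gs); split; last by rewrite leq_addr.
  split.
  - by apply/wf_gates_rcons.
  - by rewrite /= size_rcons addnS leqnn.
  - move=> T x0 f vs sz_vs.
    by rewrite -sz_vs /= nth_propagate_last lab.
  - rewrite /wire_count map_rcons sumn_rcons -/(wire_count gs) wi /= addn0 rs_n.
    exact: addnC.
  - by move=> p; rewrite /gates_all all_rcons /= -/(gates_all p gs) al rs_n andbT.
  - move=> x; have := fan x; rewrite fan_in_rcons !count_cat /= addn0.
    case: ltnP => [lt_xb|le_bx] c.
      have -> : (b + size gs == x) = false by lia.
      by rewrite !addn0.
    case: eqP c => [<- _|_]; last by rewrite addn0.
    by rewrite (count_mem0 (fan_in_wf wf)) ?(count_mem0 ro) -?leqNgt.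
elim: IH b lt_ts => [|t {}ts IHt _ IHts] b /=; first by exists [::], [::]; exact: forest_nil.
rewrite all_cat => /andP[lt_t lt_ts].
have [g1 [r1 sp1]] := IHt b lt_t.
have [|g2 [rs sp2]] := IHts (b + size g1).
  by apply: sub_all lt_ts => j /leq_trans; apply; rewrite leq_addr.
by exists (g1 ++ g2), (r1 :: rs); apply: forest_cons.
Qed.

Lemma forest_compile b ts :
  all (fun j => j < b) (flatten (map leaves ts)) ->
  exists gs rs, forest_spec b ts gs rs.
Proof.
elim: ts b => [|t ts IH] b /=; first by exists [::], [::]; exact: forest_nil.
rewrite all_cat => /andP[lt_t lt_ts].
have [g1 [r1 sp1]] := tree_compile lt_t.
have [|g2 [rs sp2]] := IH (b + size g1).
  by apply: sub_all lt_ts => j /leq_trans; apply; rewrite leq_addr.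
by exists (g1 ++ g2), (r1 :: rs); apply: forest_cons.
Qed.

(** * Substituting formulas for the inputs of a circuit *)

(** Two instances matter: equality, for truth values, and [d <= d' + D], for levels. *)
Definition label_compat (T : Type) (x0 : T) (f : gate_kind -> seq T -> T)
    (rel : T -> T -> Prop) : Prop :=
  forall k xs ys, size xs = size ys ->
    (forall i, i < size xs -> rel (nth x0 xs i) (nth x0 ys i)) ->
    rel (f k xs) (f k ys).

(** [mp] sends a gate to its image. The last clause lets fan-out one survive, as the class [Formula]
    requires: no image is read more often than the original gate. *)
Record subst_spec (n l : nat) (h : nat -> tree) (gs gs' : seq gate)
    (mp : nat -> nat) : Prop := SubstSpec {
  subst_wf : wf_gates l gs';
  subst_range : forall i, i < size gs -> l <= mp i < l + size gs';
  subst_inj : {in gtn (size gs) &, injective mp};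
  subst_wires : forall W, (forall j, j < n -> tree_wires (h j) <= W) ->
    wire_count gs' <= wire_count gs * W.+1;
  subst_all : forall p, gates_all p gs ->
    (forall j, j < n -> tree_all p (h j)) -> gates_all p gs';
  subst_label : forall T (x0 : T) f rel, label_compat x0 f rel ->
    forall vs vs', size vs = n -> size vs' = l ->
    (forall j, j < n -> rel (tree_label f (nth x0 vs') (h j)) (nth x0 vs j)) ->
    forall i, i < size gs -> rel (nth x0 (propagate x0 f vs' gs') (mp i))
                                 (nth x0 (propagate x0 f vs gs) (n + i));
  subst_fan : (forall x, n <= x -> count_mem x (fan_in gs) <= 1) ->
    (forall x, l <= x -> count_mem x (fan_in gs') <= 1) /\
    (forall i, i < size gs ->
       count_mem (mp i) (fan_in gs') <= count_mem (n + i) (fan_in gs)) }.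

(** A fresh copy of [h j] is made for each wire that reads input j, so that the gates of the
    formulas are never shared. *)
Definition redirect (n : nat) (h : nat -> tree) (mp : nat -> nat) (j : nat) : tree :=
  if j < n then h j else Leaf (mp (j - n)).

Lemma redirect_leaves n l h m mp j b :
  (forall j, j < n -> all (fun x => x < l) (leaves (h j))) ->
  (forall i, i < m -> l <= mp i < b) -> l <= b ->
  j < n + m -> all (fun x => x < b) (leaves (redirect n h mp j)).
Proof.
move=> lt_h lt_mp le_lb lt_j; rewrite /redirect; case: ltnP => lt_jn.
  by apply: sub_all (lt_h _ lt_jn) => x /leq_trans; apply.
by rewrite /= andbT; have := lt_mp (j - n); lia.
Qed.

(* Beyond the [l] inputs, the trees standing for the arguments [s] read
   exactly the images of the gates of [s]. *)
Lemma redirect_count n l h m mp s x :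
  (forall j, j < n -> all (fun x => x < l) (leaves (h j))) ->
  all (fun j => j < n + m) s -> l <= x ->
  count_mem x (flatten [seq leaves (redirect n h mp j) | j <- s]) =
  count (fun j => (n <= j) && (mp (j - n) == x)) s.
Proof.
move=> lt_h; elim: s => //= j s IH /andP[lt_j lt_s] le_lx.
rewrite count_cat IH // /redirect; case: ltnP => lt_jn /=; last by rewrite addn0.
by rewrite (count_mem0 (lt_h _ lt_jn)) // -leqNgt.
Qed.

Lemma redirect_label n l h m mp gs gs' T (x0 : T) f rel vs vs' j :
  (forall j, j < n -> all (fun x => x < l) (leaves (h j))) ->
  (forall i, i < m -> rel (nth x0 (propagate x0 f vs' gs') (mp i))
                          (nth x0 (propagate x0 f vs gs) (n + i)) : Prop) ->
  size vs = n -> size vs' = l ->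
  (forall j, j < n -> rel (tree_label f (nth x0 vs') (h j)) (nth x0 vs j)) ->
  j < n + m ->
  rel (tree_label f (nth x0 (propagate x0 f vs' gs')) (redirect n h mp j))
      (nth x0 (propagate x0 f vs gs) j).
Proof.
move=> lt_h lab sz_vs sz_vs' lab_h lt_j; rewrite /redirect.
case: ltnP => lt_jn; last by have := lab (j - n); rewrite subnKC //=; apply; lia.
rewrite nth_propagate ?sz_vs //.
rewrite (@tree_label_ext _ _ _ (nth x0 vs')); first exact: lab_h.
by move=> y /(allP (lt_h _ lt_jn)) lt_y; rewrite nth_propagate ?sz_vs'.
Qed.

Lemma subst_gates n l h gs :
  wf_gates n gs ->
  (forall j, j < n -> all (fun x => x < l) (leaves (h j))) ->
  exists gs' mp, subst_spec n l h gs gs' mp.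
Proof.
move=> + lt_h; elim/last_ind: gs => [_|gs g IH /wf_gates_rcons[wf lt_g]].
  by exists [::], id; split.
have [gs1 [mp [wf1 rng1 inj1 wi1 al1 lab1 fan1]]] := IH wf.
set b := l + size gs1.
pose t := Node (kind g) (map (redirect n h mp) (args g)).
have lt_t : all (fun x => x < b) (leaves t).
  rewrite /= -map_comp; elim: (args g) lt_g => //= j s IHs /andP[lt_j /IHs lt_s].
  by rewrite all_cat lt_s andbT (redirect_leaves lt_h rng1 (leq_addr _ _)).
have [gs2 [r [[wf2 ro2 lab2 wi2 al2 fan2] root2]]] := tree_compile lt_t.
have {root2} le_br : b <= r := root2.
have lt_r : r < b + size gs2 by move: ro2; rewrite /= andbT.
have mpE i : i < size gs -> l <= mp i < b by exact: rng1.
exists (gs1 ++ gs2), (fun i => if i < size gs then mp i else r); split.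
- exact: wf_gates_cat.
- move=> i; rewrite size_rcons size_cat ltnS addnA -/b => le_i.
  by case: ltnP => [/mpE|]; rewrite /b in le_br *; lia.
- move=> i i'; rewrite !inE size_rcons !ltnS => le_i le_i'.
  case: ltnP => lt_i; case: ltnP => lt_i' eq_mp; first exact: inj1.
  + by have := mpE _ lt_i; lia.
  + by have := mpE _ lt_i'; lia.
  + by lia.
- move=> W le_W; rewrite /wire_count map_rcons map_cat sumn_rcons sumn_cat.
  rewrite -!/(wire_count _) wi2 /= addn0 mulnDl leq_add ?wi1 //.
  rewrite size_map mulnS leq_add2l -map_comp.
  elim: (args g) => //= j s IHs; rewrite mulSn leq_add // /redirect.
  by case: ltnP => // /le_W.
- move=> p; rewrite /gates_all all_rcons all_cat -!/(gates_all _ _) al2 /= andbT.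
  move=> /andP[p_g p_gs] p_h; rewrite al1 //= size_map p_g /= all_map.
  by apply/allP => j _ /=; rewrite /redirect; case: ltnP => // /p_h.
- move=> T x0 f rel compat vs vs' sz_vs sz_vs' lab_h i.
  have lab := lab1 T x0 f rel compat vs vs' sz_vs sz_vs' lab_h.
  rewrite size_rcons ltnS propagate_cat => le_i; case: ltnP => lt_i.
    rewrite propagate_rcons nth_rcons size_propagate sz_vs ltn_add2l lt_i.
    rewrite nth_propagate; first exact: lab.
    by rewrite size_propagate sz_vs' -/b; case/andP: (mpE _ lt_i).
  have {le_i lt_i} -> : i = size gs by lia.
  rewrite -[in n + _]sz_vs nth_propagate_last.
  have sz1 : size (propagate x0 f vs' gs1) = b by rewrite size_propagate sz_vs'.
  have [->] := lab2 T x0 f _ sz1; rewrite /= -map_comp; apply: compat; first by rewrite !size_map.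
  move=> m; rewrite size_map => lt_m.
  rewrite !(nth_map 0) //=; apply: (redirect_label lt_h lab sz_vs sz_vs' lab_h).
  exact: (allP lt_g _ (mem_nth 0 lt_m)).
- move=> fan_gs.
  have [|fan3 fan4] := fan1.
    by move=> x /fan_gs; rewrite fan_in_rcons count_cat; lia.
  have cnt_t x : l <= x -> count_mem x (flatten (map leaves [:: t])) =
      count (fun j => (n <= j) && (mp (j - n) == x)) (args g).
    by move=> le_lx; rewrite /= cats0 -map_comp (redirect_count _ lt_h lt_g).
  have cnt_mp i : i < size gs ->
      count_mem (mp i) (flatten (map leaves [:: t])) = count_mem (n + i) (args g).
    move=> lt_i; rewrite cnt_t; last by case/andP: (mpE _ lt_i).
    apply: eq_in_count => j /(allP lt_g) lt_j /=.
    apply/andP/eqP => [[le_nj /eqP /inj1 eqj]|->].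
      by rewrite -(eqj _ lt_i) ?subnKC // inE; lia.
    by rewrite leq_addr addKn eqxx.
  have cnt_r : count_mem r (fan_in (gs1 ++ gs2)) = 0.
    rewrite fan_in_cat count_cat (count_mem0 (fan_in_wf wf1)) -?leqNgt //.
    by have := fan2 r; rewrite ltnNge le_br count_cat /= eqxx; lia.
  split=> [x le_lx|i]; last first.
    rewrite size_rcons ltnS fan_in_rcons count_cat => le_i; case: ltnP => lt_i.
      rewrite fan_in_cat count_cat leq_add ?fan4 // -cnt_mp //.
      have /andP[_ lt_b] := mpE _ lt_i.
      by apply: leq_trans (_ : _ <= count_mem (mp i) (fan_in gs2 ++ [:: r])) _;
        [rewrite count_cat leq_addr | have := fan2 (mp i); rewrite lt_b].
    by rewrite cnt_r.
  rewrite fan_in_cat count_cat.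
  have := fan2 x; rewrite count_cat; case: ltnP => [lt_xb|le_bx]; last first.
    by rewrite (count_mem0 (fan_in_wf wf1)) -?leqNgt //; lia.
  (* Such a node is either the image of an old gate, whose readers are compared with those of that
     gate, or an interior node of an earlier formula, which the new tree does not mention. *)
  have [/existsP[i /eqP eq_x]|/existsPn no_x] :=
      boolP [exists i : 'I_(size gs), mp i == x].
    subst x; rewrite cnt_mp // => le2; have := fan_gs (n + i) (leq_addr _ _).
    rewrite fan_in_rcons count_cat; have := fan4 i (ltn_ord i); lia.
  suff -> : count_mem x (flatten (map leaves [:: t])) = 0 by have := fan3 x le_lx; lia.
  rewrite cnt_t //; apply/eqP; rewrite -leqn0 leqNgt -has_count; apply/hasPn => j.
  move=> /(allP lt_g) lt_j; apply/andP => -[le_nj /eqP eq_x].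
  have lt_m : j - n < size gs by lia.
  by have := no_x (Ordinal lt_m); rewrite /= eq_x eqxx.
Qed.

(** * Truth tables as formulas *)

Definition words (m : nat) : seq (seq bool) := map val (enum {: m.-tuple bool}).

Lemma mem_words m w : (w \in words m) = (size w == m).
Proof.
apply/mapP/eqP => [[t _ ->]|sz_w]; first exact: size_tuple.
by move/eqP: sz_w => sz_w; exists (Tuple sz_w); rewrite ?mem_enum.
Qed.

Lemma size_words m : size (words m) = 2 ^ m.
Proof. by rewrite size_map -cardE card_tuple card_bool. Qed.

Definition literal (b : bool) (t : tree) : tree := if b then t else Node GNot [:: t].

Definition dnf (ts : seq tree) (T : seq bool -> bool) : tree :=
  Node GOr [seq Node GAnd [seq literal p.2 p.1 | p <- zip ts w]
           | w <- words (size ts) & T w].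

Fixpoint decision (ts : seq tree) (T : seq bool -> bool) : tree :=
  if ts is t :: ts' then
    Node GOr [:: Node GAnd [:: t; decision ts' (fun w => T (true :: w))];
                 Node GAnd [:: Node GNot [:: t]; decision ts' (fun w => T (false :: w))]]
  else Node (if T [::] then GAnd else GOr) [::].

(* Arbitrary truth tables: as a DNF when the fan-in is unbounded, to keep the
   depth constant, and by Shannon expansion when the fan-in is two. *)
Definition table (unbounded : bool) : seq tree -> (seq bool -> bool) -> tree :=
  if unbounded then dnf else decision.

Definition basic_gate (unbounded : bool) (k : gate_kind) (m : nat) : bool :=
  match k with
  | GAnd | GOr => unbounded || (m <= 2)
  | GNot => m == 1
  | _ => false
  end.

Lemma literal_value O leaf b t :
  tree_label (gate_sem O) leaf (literal b t) = (tree_label (gate_sem O) leaf t == b).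
Proof. by case: b => /=; [rewrite eqb_id | rewrite eqbF_neg]. Qed.

Lemma dnf_value O leaf ts T :
  tree_label (gate_sem O) leaf (dnf ts T) =
  T [seq tree_label (gate_sem O) leaf t | t <- ts].
Proof.
set vs := [seq _ | _ <- ts].
rewrite /= -map_comp has_map.
have sz_vs : size vs = size ts by rewrite size_map.
have andE w : size w = size ts ->
    all id [seq tree_label (gate_sem O) leaf (literal p.2 p.1) | p <- zip ts w]
    = (w == vs).
  rewrite /vs; elim: ts w {vs sz_vs} => [|t ts IH] [|b w] //= [sz_w].
  by rewrite literal_value IH // eqseq_cons eq_sym.
apply/hasP/idP => [[w]|Tvs].
  rewrite mem_filter mem_words => /andP[Tw /eqP sz_w] /=.
  by rewrite -map_comp andE // => /eqP <-.
exists vs; first by rewrite mem_filter Tvs mem_words sz_vs /=.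
by rewrite /= -map_comp andE.
Qed.

Lemma decision_value O leaf ts T :
  tree_label (gate_sem O) leaf (decision ts T) =
  T [seq tree_label (gate_sem O) leaf t | t <- ts].
Proof.
elim: ts T => [|t ts IH] T /=; first by case: (T [::]).
by rewrite !IH; case: (tree_label _ _ t) => /=; rewrite ?andbT ?andbF ?orbF.
Qed.

Lemma table_value unb O leaf ts T :
  tree_label (gate_sem O) leaf (table unb ts T) =
  T [seq tree_label (gate_sem O) leaf t | t <- ts].
Proof. by case: unb; [exact: dnf_value|exact: decision_value]. Qed.

Lemma zip_forall (p : pred tree) (ts : seq tree) (w : seq bool) :
  all p ts -> all (fun q => p q.1) (zip ts w).
Proof. by elim: ts w => [|t ts IH] [|b w] //= /andP[-> /IH ->]. Qed.

Lemma table_all unb ts T :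
  all (tree_all (basic_gate unb)) ts ->
  tree_all (basic_gate unb) (table unb ts T).
Proof.
case: unb => [|] /= al.
  rewrite all_map; apply/allP => w _ /=; rewrite all_map.
  by apply: sub_all (zip_forall w al) => -[t []] //= ->.
by elim: ts T al => [|t ts IH] T /=; [case: (T [::])|case/andP => -> al; rewrite !IH].
Qed.

Lemma all_flatten (T : Type) (p : pred T) (ss : seq (seq T)) :
  all p (flatten ss) = all (all p) ss.
Proof. by elim: ss => //= s ss IH; rewrite all_cat IH. Qed.

Lemma size_fan_in gs : size (fan_in gs) = wire_count gs.
Proof. by rewrite size_flatten /shape -map_comp. Qed.

Lemma table_leaves unb p ts T :
  all (fun t => all p (leaves t)) ts -> all p (leaves (table unb ts T)).
Proof.
case: unb => al /=.
  rewrite all_flatten all_map all_map; apply/allP => w _ /=.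
  rewrite all_flatten !all_map.
  apply: (sub_all _ (zip_forall w al)).
  by move=> -[t []] //= pt; rewrite cats0.
elim: ts T al => [|t ts IH] T /=; first by case: (T [::]).
by case/andP => pt al; rewrite !cats0 !all_cat pt !IH.
Qed.

Notation tree_level := (tree_label level_op (fun _ => 0)).

Lemma level_op_leq k ds b : all (fun d => d < b) ds -> level_op k ds <= b.
Proof. by move=> /allP lt_b; apply/bigmax_leqP_seq => d /lt_b. Qed.

Lemma table_level (unb : bool) D ts T :
  all (fun t => tree_level t <= D) ts ->
  tree_level (table unb ts T) <= D + 3 * (if unb then 1 else size ts).
Proof.
case: unb => al /=.
  apply: level_op_leq; rewrite !all_map; apply/allP => w _ /=.
  rewrite addn3 ltnS; apply: level_op_leq; rewrite !all_map.
  apply: (sub_all _ (zip_forall w al)) => -[t []] /=; first exact: leqW.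
  by move=> le_D; rewrite ltnS; apply: level_op_leq; rewrite /= andbT.
elim: ts T al => [|t ts IH] T /=; first by case: (T [::]); rewrite /level_op big_nil.
case/andP => le_D al; apply: level_op_leq => /=.
have lo1 x y b : x < b -> y < b -> level_op GAnd [:: x; y] <= b.
  by move=> ltx lty; apply: level_op_leq; rewrite /= ltx lty.
have lo2 x b : x < b -> level_op GNot [:: x] <= b.
  by move=> ltx; apply: level_op_leq; rewrite /= ltx.
have -> : D + 3 * (size ts).+1 = (D + 3 * size ts).+3 by lia.
have le_t : tree_level t <= D + 3 * size ts by rewrite (leq_trans le_D) ?leq_addr.
by rewrite andbT; apply/andP; split; rewrite ltnS; apply: lo1;
  try (rewrite ltnS; apply: lo2); rewrite ltnS ?leqW ?IH.
Qed.

Lemma sumn_leq_const (T : Type) (F : T -> nat) (s : seq T) b :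
  all (fun x => F x <= b) s -> sumn (map F s) <= size s * b.
Proof. by elim: s => //= x s IH /andP[le_b /IH le_s]; rewrite mulSn leq_add. Qed.

(** A DNF has at most 2^m terms of m literals, and m < 2^m; a Shannon step adds at most 7 + 2w wires
    to two recursive calls, which fits in the factor 4. *)
Lemma table_wires unb w ts T :
  all (fun t => tree_wires t <= w) ts ->
  tree_wires (table unb ts T) <= 4 ^ size ts * (7 + 2 * w).
Proof.
have pow_gt m : m < 2 ^ m by exact: ltn_expl.
case: unb => al /=.
  set m := size ts; set s := [seq x <- _ | _].
  have le_s : size s <= 2 ^ m by rewrite -(size_words m) size_filter count_size.
  rewrite size_map -map_comp.
  have le_and : all (fun x => tree_wires (Node GAnd [seq literal p.2 p.1 | p <- zip ts x])
                               <= m * (2 + w)) s.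
    apply/allP => x _ /=; rewrite size_map -map_comp.
    have szz : size (zip ts x) <= m by rewrite size_zip geq_minl.
    apply: leq_trans (_ : size (zip ts x) * (2 + w) <= _); last by rewrite leq_mul2r szz orbT.
    rewrite mulnC add2n mulSn leq_add2l mulnC; apply: sumn_leq_const.
    by apply: (sub_all _ (zip_forall x al)) => -[t []] /=; lia.
  apply: leq_trans (_ : 2 ^ m + 2 ^ m * (m * (2 + w)) <= _).
    rewrite leq_add // (leq_trans (sumn_leq_const le_and)) //.
    by rewrite leq_mul2r le_s orbT.
  rewrite (_ : 4 = 2 * 2) // expnMn -mulnA.
  have := pow_gt m; set q := 2 ^ m => lt_mq; rewrite -[X in X + _]muln1 -mulnDr.
  by rewrite leq_mul2l; apply/orP; right; nia.
elim: ts T al => [|t ts IH] T /=; first by case: (T [::]).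
case/andP => le_w al; have := IH (fun w => T (true :: w)) al.
have := IH (fun w => T (false :: w)) al; rewrite expnS.
have : 0 < 4 ^ size ts by rewrite expn_gt0.
set q := 4 ^ _; set x := q * _; move=> q_gt0 le1 le2.
have : 7 + 2 * w <= x by rewrite /x leq_pmull.
by rewrite -mulnA -/x; lia.
Qed.

(** * Substitution inside a circuit class *)

Lemma wf_circuitP n c :
  wf_circuit n c <-> wf_gates n (gates c) /\ output c < n + size (gates c).
Proof.
split=> [/andP[/forallP wf lt_o]|[wf lt_o]].
  by split=> // i lt_i; exact: (wf (Ordinal lt_i)).
by apply/andP; split=> //; apply/forallP => i; exact: wf.
Qed.

Lemma wiresE c : wires c = wire_count (gates c).
Proof. by rewrite /wires /wire_count sumnE big_map. Qed.

Lemma gate_allowedE C u g :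
  gate_allowed C u g = gate_allowed C u (Gate (kind g) (nseq (size (args g)) 0)).
Proof. by case: g => k a; rewrite /gate_allowed /= size_nseq. Qed.

Definition allowed C u (k : gate_kind) (m : nat) : bool :=
  ~~ is_oracle k && gate_allowed C u (Gate k (nseq m 0)).

Lemma circuit_ofE C u n s c :
  circuit_of C u n s c =
  [&& wf_circuit n c, wires c <= s, shape_ok C u n s c & gates_all (allowed C u) (gates c)].
Proof.
rewrite /circuit_of /oracle_circuit_of -!andbA; do 3 congr (_ && _).
rewrite /gates_all -all_predI; congr (_ && _); apply: eq_all => g /=.
rewrite /allowed -gate_allowedE.
by case: (is_oracle _) => //=; rewrite andbT.
Qed.

Lemma allowed_mono C u v k m :
  modulus_bound u <= modulus_bound v -> allowed C u k m -> allowed C v k m.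
Proof.
move=> le_uv; rewrite /allowed /gate_allowed; case: k => //= q; case: C => //.
by case/andP => ->/= /leq_trans; apply.
Qed.

Lemma basic_allowed C u k m : basic_gate (unbounded_fanin C) k m -> allowed C u k m.
Proof. by case: k; rewrite /allowed /gate_allowed /= ?size_nseq. Qed.

Lemma gates_all_impl (p q : gate_kind -> nat -> bool) gs :
  (forall k m, p k m -> q k m) -> gates_all p gs -> gates_all q gs.
Proof. by move=> pq; apply: sub_all => g; exact: pq. Qed.

Lemma tree_all_impl (p q : gate_kind -> nat -> bool) t :
  (forall k m, p k m -> q k m) -> tree_all p t -> tree_all q t.
Proof.
move=> pq; elim/tree_all_ind: t => //= k ts IH /andP[/pq -> /=].
by elim: IH => //= t {}ts IHt _ IHts /andP[/IHt -> /IHts].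
Qed.

Lemma level_compat D : label_compat 0 level_op (fun d d' => d <= d' + D).
Proof.
move=> k xs ys eq_sz le_xy; apply: level_op_leq; apply/allP => d /(nthP 0)[i lt_i <-].
rewrite (leq_ltn_trans (le_xy i lt_i)) // ltn_add2r.
by apply: (@leq_bigmax_seq _ _ xpredT succn) => //; rewrite mem_nth // -eq_sz.
Qed.

Lemma value_compat O : label_compat false (gate_sem O) eq.
Proof. by move=> k xs ys eq_sz eq_xy; congr (gate_sem O k _); exact: eq_from_nth eq_xy. Qed.

Lemma fanout_oneP n c : fanout_one n c <->
  forall i, i < size (gates c) -> count_mem (n + i) (fan_in (gates c)) <= 1.
Proof.
split=> [/forallP fan i lt_i|fan]; first exact: (fan (Ordinal lt_i)).
by apply/forallP => i; exact: fan.
Qed.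

(** The formulas use only AND, OR and NOT, the depth grows additively by [D], and fan-out one is
    preserved, so the class does not change. In [NC1] the additional depth is paid for by the larger
    size bound. *)
Lemma substitute_circuit C u v n l s s' W D (h : nat -> tree) c :
  (forall j, j < n -> all (fun x => x < l) (leaves (h j))) ->
  (forall j, j < n -> tree_all (basic_gate (unbounded_fanin C)) (h j)) ->
  (forall j, j < n -> tree_wires (h j) <= W) ->
  (forall j, j < n -> tree_level (h j) <= D) ->
  (unbounded_fanin C -> depth_bound u + D <= depth_bound v) ->
  modulus_bound u <= modulus_bound v ->
  s.+1 * W.+1 <= s' ->
  (if C is NC1 a then s ^ a * 2 ^ D <= s' ^ a else true) ->
  circuit_of C u n s c ->
  exists2 c', circuit_of C v l s' c' &
    forall O x x', size x = n -> size x' = l ->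
      (forall j, j < n -> tree_label (gate_sem O) (nth false x') (h j) = nth false x j) ->
      Defs.eval O c' x' = Defs.eval O c x.
Proof.
move=> lt_h all_h le_W le_D le_dep le_mod le_s' le_nc1.
rewrite circuit_ofE => /and4P[/wf_circuitP[wf lt_o] le_s shape al].
have [gs1 [mp [wf1 rng1 inj1 wi1 al1 lab1 fan1]]] := subst_gates wf lt_h.
have all_h' j : j < n -> tree_all (allowed C v) (h j).
  by move=> /all_h; apply: tree_all_impl => k m; exact: basic_allowed.
(* The output may itself be an input; its formula is then compiled separately, which accounts for
   the summand 1 in [s.+1]. *)
pose t := redirect n h mp (output c).
have lt_t : all (fun j => j < l + size gs1) (leaves t).
  exact: (redirect_leaves lt_h rng1 (leq_addr _ _) lt_o).
have [gs2 [r [[wf2 ro2 lab2 wi2 al2 fan2] _]]] := tree_compile lt_t.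
have lab T (x0 : T) f rel vs vs' : label_compat x0 f rel ->
    size vs = n -> size vs' = l ->
    (forall j, j < n -> rel (tree_label f (nth x0 vs') (h j)) (nth x0 vs j)) ->
    rel (nth x0 (propagate x0 f vs' (gs1 ++ gs2)) r)
        (nth x0 (propagate x0 f vs (gates c)) (output c)).
  move=> compat sz_vs sz_vs' lab_h; rewrite propagate_cat.
  have sz1 : size (propagate x0 f vs' gs1) = l + size gs1 by rewrite size_propagate sz_vs'.
  have [->] := lab2 T x0 f _ sz1.
  apply: (redirect_label lt_h _ sz_vs sz_vs' lab_h lt_o).
  exact: (lab1 T x0 f rel compat vs vs' sz_vs sz_vs' lab_h).
have le_depth : depth l (Circ (gs1 ++ gs2) r) <= depth n c + D.
  have := lab nat 0 level_op _ (nseq n 0) (nseq l 0) (level_compat (D := D)).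
  apply; rewrite ?size_nseq // => j lt_j.
  rewrite (@tree_label_ext _ _ _ (fun _ => 0)) ?(leq_trans (le_D _ lt_j)) ?leq_addl //.
  by move=> x _; rewrite nth_nseq; case: ifP.
exists (Circ (gs1 ++ gs2) r); last first.
  move=> O x x' sz_x sz_x' val_h; exact: (lab _ _ _ _ _ _ (@value_compat O)).
rewrite circuit_ofE; apply/and4P; split.
- apply/wf_circuitP; split; first exact: wf_gates_cat.
  by move: ro2; rewrite /= andbT size_cat addnA.
- apply: leq_trans le_s'; rewrite wiresE /= /wire_count map_cat sumn_cat.
  rewrite -!/(wire_count _) wi2 /= addn0 mulSn addnC leq_add //.
    by rewrite /t /redirect; case: ltnP => // /le_W /leqW.
  by apply: leq_trans (wi1 _ le_W) _; rewrite leq_mul2r -wiresE le_s orbT.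
- case: C shape le_dep le_nc1 {al all_h all_h'} => //=;
    try by move=> *; apply: leq_trans le_depth _; lia.
  + move=> a shape _ le_nc1; apply: leq_trans le_nc1.
    apply: leq_trans (_ : 2 ^ (depth n c + D) <= _); first by rewrite leq_exp2l.
    by rewrite expnD leq_mul2r shape orbT.
  + move=> shape _ _; apply/fanout_oneP => i lt_i /=.
    have [|fan3 fan4] := fan1.
      move=> x le_nx; have [lt_x|le_x] := ltnP x (n + size (gates c)).
        have /fanout_oneP := shape; move/(_ (x - n)); rewrite subnKC //; apply; lia.
      by rewrite (count_mem0 (fan_in_wf wf)) -?leqNgt.
    have := leq_addr i l; move: (l + i) => x le_lx.
    rewrite fan_in_cat count_cat.
    have := fan2 x; rewrite count_cat; case: (ltnP x (l + size gs1)) => [lt_xb|le_bx].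
      (* If the output is a gate, its tree is a leaf and [gs2] has no wires; if it is an input,
         [gs2] reads only inputs and its own gates. *)
      move: wi2; rewrite -size_fan_in /t /redirect /= !cats0 !addn0.
      have := fan3 x le_lx.
      case: ltnP => [lt_on|le_no] /= le1; last by move=> /size0nil -> /=; lia.
      by rewrite (count_mem0 (lt_h _ lt_on)) -?leqNgt //; lia.
    rewrite (count_mem0 (fan_in_wf wf1)) ?add0n; last by rewrite -leqNgt.
    exact: leq_trans (leq_addr _ _).
- rewrite /gates_all all_cat -!/(gates_all _ _) al2 /= andbT al1 //=.
    by rewrite /t /redirect; case: ltnP => // /all_h'.
  by apply: gates_all_impl al => k m; exact: allowed_mono.
Qed.

(** * The Nisan-Wigderson generator and the oracle query *)

Definition xor_all : seq bool -> bool := foldr addb false.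

Definition block (r j : nat) (x : seq bool) : seq bool :=
  [seq nth false x (j * r + i) | i <- iota 0 r].

(* The design is S_x = {(a, address a x)}: [T a j b] gives the contribution of
   the j-th block of x to the b-th bit of the address. *)
Definition address (r d : nat) (T : nat -> nat -> nat -> seq bool -> bool)
    (a : nat) (x : seq bool) : seq bool :=
  [seq xor_all [seq T a j b (block r j x) | j <- iota 0 d] | b <- iota 0 r].

(** The seed is a Boolean table with n rows of 2^r points; x selects one point in each row. *)
Definition nw_input (r d : nat) (T : nat -> nat -> nat -> seq bool -> bool)
    (n : nat) (z : nat -> seq bool -> bool) (x : seq bool) : seq bool :=
  [seq z a (address r d T a x) | a <- iota 0 n].

(** Three nested tables: on the r bits of a block, on d bits for the XOR, and on the r address bits
    to look up the seed. Each is polynomial in 2^r for fixed d. *)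
Definition address_tree (unb : bool) (r d : nat) (T : nat -> nat -> nat -> seq bool -> bool)
    (a : nat) (z : seq bool -> bool) : tree :=
  table unb [seq table unb [seq table unb [seq Leaf (j * r + i) | i <- iota 0 r] (T a j b)
                           | j <- iota 0 d] xor_all
            | b <- iota 0 r] z.

Section AddressTree.
Variables (unb : bool) (r d : nat) (T : nat -> nat -> nat -> seq bool -> bool).
Variables (a : nat) (z : seq bool -> bool).

Lemma address_tree_value O x :
  tree_label (gate_sem O) (nth false x) (address_tree unb r d T a z) =
  z (address r d T a x).
Proof.
rewrite table_value -map_comp; congr z; apply: eq_map => b /=.
rewrite table_value -map_comp; congr xor_all; apply: eq_map => j /=.
by rewrite table_value -map_comp.
Qed.

Lemma address_tree_leaves : all (fun j => j < d * r) (leaves (address_tree unb r d T a z)).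
Proof.
apply: table_leaves; rewrite all_map; apply/allP => b _ /=.
apply: table_leaves; rewrite all_map; apply/allP => j; rewrite mem_iota add0n => lt_j /=.
apply: table_leaves; rewrite all_map; apply/allP => i; rewrite mem_iota add0n => lt_i /=.
by rewrite andbT; nia.
Qed.

Lemma address_tree_all : tree_all (basic_gate unb) (address_tree unb r d T a z).
Proof.
apply: table_all; rewrite all_map; apply/allP => b _ /=.
apply: table_all; rewrite all_map; apply/allP => j _ /=.
by apply: table_all; rewrite all_map; apply/allP => i _ /=.
Qed.

Lemma address_tree_wires :
  tree_wires (address_tree unb r d T a z) <=
  4 ^ r * (7 + 2 * (4 ^ d * (7 + 2 * (4 ^ r * 7)))).
Proof.
apply: leq_trans (table_wires _ _ (w := 4 ^ d * (7 + 2 * (4 ^ r * 7))) _) _;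
  last by rewrite size_map size_iota.
rewrite all_map; apply/allP => b _ /=.
apply: leq_trans (table_wires _ _ (w := 4 ^ r * 7) _) _;
  last by rewrite size_map size_iota.
rewrite all_map; apply/allP => j _ /=.
apply: leq_trans (table_wires _ _ (w := 0) _) _;
  last by rewrite size_map size_iota.
by rewrite all_map; apply/allP => i _ /=.
Qed.

Lemma address_tree_level :
  tree_level (address_tree unb r d T a z) <= if unb then 9 else 6 * r + 3 * d.
Proof.
pose e m := 3 * (if unb then 1 else m).
apply: leq_trans (table_level _ _ (D := e r + e d) _) _;
  last by rewrite size_map size_iota /e; case: (unb); lia.
rewrite all_map; apply/allP => b _ /=.
apply: leq_trans (table_level _ _ (D := e r) _) _;
  last by rewrite size_map size_iota /e; case: (unb); lia.
rewrite all_map; apply/allP => j _ /=.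
apply: leq_trans (table_level _ _ (D := 0) _) _;
  last by rewrite size_map size_iota /e; case: (unb); lia.
by rewrite all_map; apply/allP => i _ /=.
Qed.

End AddressTree.

(** The seed is hard-wired. The 9 stands for three levels in each of the three nested tables. *)
Lemma nw_circuit C u v n s s' r d T (z : nat -> seq bool -> bool) (f : language) :
  (unbounded_fanin C -> depth_bound u + 9 <= depth_bound v) ->
  modulus_bound u <= modulus_bound v ->
  s.+1 * (4 ^ r * (7 + 2 * (4 ^ d * (7 + 2 * (4 ^ r * 7))))).+1 <= s' ->
  (if C is NC1 a then s ^ a * 2 ^ (6 * r + 3 * d) <= s' ^ a else true) ->
  has_circuit C u s (fun x : n.-tuple bool => f x) ->
  has_circuit C v s' (fun x : (d * r).-tuple bool => f (nw_input r d T n z x)).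
Proof.
move=> le_dep le_mod le_s' le_nc1 [c [c_ok c_f]].
pose unb := unbounded_fanin C.
have [] // := @substitute_circuit C u v n (d * r) s s' _
  (if unb then 9 else 6 * r + 3 * d) (fun a => address_tree unb r d T a (z a)) c
  _ _ (fun j _ => address_tree_wires unb r d T j (z j)) _ _ _ _ _ c_ok.
- by move=> j _; exact: address_tree_leaves.
- by move=> j _; exact: address_tree_all.
- by move=> j _; exact: address_tree_level.
- by rewrite /unb; case: (unbounded_fanin C) le_dep => // /(_ isT).
- by rewrite /unb; case: C le_nc1 {le_dep c_ok unb}.
move=> c' c'_ok c'E; exists c'; split=> // x.
have sz_y : size (nw_input r d T n z x) == n by rewrite size_map size_iota.
rewrite (c'E _ (nw_input r d T n z x)) ?size_tuple ?(eqP sz_y) //.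
  exact: (c_f (Tuple sz_y)).
move=> j lt_j; rewrite address_tree_value (nth_map 0) ?size_iota //.
by rewrite nth_iota ?add0n.
Qed.

Lemma tree_no_oracle leaf t :
  (forall j, leaf j = false) -> tree_all (basic_gate true) t ->
  tree_label (fun k bs => is_oracle k || has id bs) leaf t = false.
Proof.
move=> leafF; elim/tree_all_ind: t => [j _|k ts IH] /=; first exact: leafF.
case/andP => bk al; have -> /= : is_oracle k = false by case: k bk.
by elim: IH al {bk} => //= t {}ts IHt _ IHts /andP[/IHt -> /IHts].
Qed.

Lemma nonadaptive_single n c :
  count (fun g => is_oracle (kind g)) (gates c) <= 1 ->
  all (fun g => is_oracle (kind g) ==>
         all (fun j => ~~ nth false (above_oracle n c) j) (args g)) (gates c) ->
  nonadaptive n c.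
Proof.
move=> le1 above; apply/andP; split=> //.
set s := [seq _ | _ <- _ & _].
suff : size s <= 1 by case: s => [|x []].
rewrite size_map size_filter; apply: leq_trans le1.
by rewrite -[X in _ <= count _ X](mkseq_nth (Gate GAnd [::])) count_map.
Qed.

(** All trees feed a single oracle gate, followed by a negation when [neg] holds: at most two more
    levels, and one wire beyond the arguments of the oracle. *)
Lemma oracle_query n ts (neg : bool) D :
  all (fun t => all (fun j => j < n) (leaves t)) ts ->
  all (tree_all (basic_gate true)) ts ->
  all (fun t => tree_level t <= D) ts ->
  exists c, [/\ oracle_circuit_of AC0 (Consts D.+2 0) n
                  (size ts + sumn (map tree_wires ts) + 1) c,
    nonadaptive n c &
    forall O x, size x = n -> Defs.eval O c x =
      neg (+) O [seq tree_label (gate_sem O) (nth false x) t | t <- ts]].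
Proof.
move=> lt_ts all_ts le_D.
have [|gs [rs [wf ro lab wi al _]]] := @forest_compile n ts.
  by rewrite all_flatten all_map.
have sz_rs : size rs = size ts.
  have := lab nat 0 level_op (nseq n 0) (size_nseq _ _).
  by move/(congr1 size); rewrite !size_map.
have al_gs : gates_all (basic_gate true) gs by rewrite al.
pose o := rcons gs (Gate GOracle rs).
pose m := n + size gs.
pose c := if neg then Circ (rcons o (Gate GNot [:: m])) m.+1 else Circ o m.
have gatesE : gates c = o ++ (if neg then [:: Gate GNot [:: m]] else [::]).
  by rewrite /c; case: (neg); rewrite ?cats0 // cats1.
have wf_o : wf_gates n o by apply/wf_gates_rcons.
have lt_rs j T (x0 : T) f vs : size vs = n -> j \in rs ->
    nth x0 (propagate x0 f vs o) j = nth x0 (propagate x0 f vs gs) j.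
  move=> sz_vs /(allP ro) lt_j.
  by rewrite propagate_rcons nth_rcons size_propagate sz_vs lt_j.
have value T (x0 : T) f vs : size vs = n ->
    nth x0 (propagate x0 f vs (gates c)) (output c) =
    if neg then f GNot [:: f GOracle [seq tree_label f (nth x0 vs) t | t <- ts]]
    else f GOracle [seq tree_label f (nth x0 vs) t | t <- ts].
  move=> sz_vs; have oE : nth x0 (propagate x0 f vs o) m =
      f GOracle [seq tree_label f (nth x0 vs) t | t <- ts].
    by rewrite /m -sz_vs nth_propagate_last /= lab.
  rewrite /c; case: (neg) => //=.
  have -> : m.+1 = size vs + size o by rewrite sz_vs size_rcons addnS.
  by rewrite nth_propagate_last /= oE.
exists c; split.
- apply/and4P; split.
  + apply/wf_circuitP; rewrite gatesE; split.
      apply: wf_gates_cat => //; case: (neg) => // -[|//] _ /=.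
      by rewrite addn0 size_rcons addnS ltnS leqnn.
    by rewrite size_cat size_rcons /c /m; case: (neg) => /=; lia.
  + rewrite wiresE gatesE /wire_count map_cat sumn_cat map_rcons sumn_rcons /=.
    rewrite -/(wire_count gs) wi sz_rs addnC addnA.
    by case: (neg) => /=; lia.
  + rewrite /shape_ok /depth /levels (value nat 0 level_op) ?size_nseq //.
    have le_o : level_op GOracle
        [seq tree_label level_op (nth 0 (nseq n 0)) t | t <- ts] <= D.+1.
      apply: level_op_leq; rewrite all_map; apply: sub_all le_D => t /= le_t.
      rewrite ltnS (@tree_label_ext _ _ _ (fun _ => 0)) // => j _.
      by rewrite nth_nseq if_same.
    case: (neg) => /=; last exact: leqW.
    by apply: level_op_leq; rewrite /= andbT ltnS.
  + rewrite gatesE all_cat all_rcons /=; apply/andP; split; last by case: (neg).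
    apply: sub_all al_gs => g /=; rewrite /gate_allowed.
    by case: (kind g) => //=.
- apply: nonadaptive_single; rewrite gatesE ?count_cat ?all_cat.
    rewrite /o -cats1 count_cat /= addn0.
    have -> : count (fun g => is_oracle (kind g)) gs = 0.
      apply/eqP; rewrite -leqn0 leqNgt -has_count -all_predC.
      by apply: sub_all al_gs => g /=; case: (kind g).
    by case: (neg).
  apply/andP; split; last by case: (neg).
  rewrite all_rcons /=; apply/andP; split; last first.
    by apply: sub_all al_gs => g; case: (kind g).
  apply/allP => j j_rs; rewrite /above_oracle gatesE propagate_cat nth_propagate; last first.
    rewrite size_propagate size_nseq size_rcons (leq_trans (allP ro _ j_rs)) //.
    by rewrite leq_add2l.
  rewrite lt_rs ?size_nseq //.
  have := lab bool false (fun k bs => is_oracle k || has id bs) (nseq n false) (size_nseq _ _).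
  move=> labE; suff /allP : all negb [seq nth false (propagate false
      (fun k bs => is_oracle k || has id bs) (nseq n false) gs) r | r <- rs].
    by apply; exact: map_f.
  rewrite labE all_map; apply: sub_all all_ts => t /= all_t.
  by rewrite tree_no_oracle // => i; rewrite nth_nseq if_same.
- move=> O x sz_x; rewrite /Defs.eval (value bool false) //=.
  by case: (neg).
Qed.

(** * The Reed-Solomon design *)

Section Design.
Import GRing.Theory VectorInternalTheory.
Local Open Scope ring_scope.

Lemma addF2_neq0 (x y : 'F_2) : (x + y != 0) = (x != 0) (+) (y != 0).
Proof. by case: x => [[|[|]] ?] //; case: y => [[|[|]] ?]. Qed.

Lemma eqF2_neq0 (x y : 'F_2) : (x != 0) = (y != 0) -> x = y.
Proof. by case: x => [[|[|]] ?] //; case: y => [[|[|]] ?] //= _; exact: val_inj. Qed.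

(** [bit] takes coordinates in a basis of GF(2^r) over the field with two elements, so that field
    addition is a bitwise XOR; [dec] rebuilds an element from its coordinates. *)
Lemma binary_field r : (0 < r)%N ->
  exists (F : finFieldType) (bit : F -> nat -> bool) (dec : seq bool -> F),
  [/\ #|F| = (2 ^ r)%N,
      (forall x y b, bit (x + y) b = bit x b (+) bit y b),
      (forall x y, (forall b, (b < r)%N -> bit x b = bit y b) -> x = y)
    & (forall w b, (b < r)%N -> bit (dec w) b = nth false w b)].
Proof.
move=> r_gt0; have [F charF cardF] := pPrimePowerField (isT : prime 2) r_gt0.
pose V := pPrimeCharType charF.
have dimV : dim V = r by rewrite -[LHS]/(logn 2 #|F|) cardF pfactorK.
pose bit (x : V) b := if insub b is Some i then v2r x ord0 i != 0 else false.
pose dec (w : seq bool) : V := r2v (\row_(i < dim V) (nth false w i)%:R).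
exists F, bit, dec; split=> //.
- move=> x y b; rewrite /bit; case: insubP => // i _ _.
  by rewrite (linearD v2r) mxE addF2_neq0.
- move=> x y eq_xy; apply: (@v2r_inj _ V); apply/rowP => i; apply: eqF2_neq0.
  by have := eq_xy i; rewrite -[X in (_ < X)%N]dimV ltn_ord /bit valK; apply.
- move=> w b; rewrite -dimV => lt_b; rewrite /bit insubT r2vK mxE /=.
  by case: (nth false w b).
Qed.

Lemma nth_block r j x i : (i < r)%N -> nth false (block r j x) i = nth false x (j * r + i)%N.
Proof. by move=> lt_i; rewrite (nth_map 0%N) ?size_iota // nth_iota ?add0n. Qed.

(* The Reed-Solomon design: the blocks of x are the coefficients of a
   polynomial of degree less than d over GF(2^r), and [address] evaluates it at
   the a-th element of the field. *)
Lemma design_exists r d n : (0 < r)%N -> (n <= 2 ^ r)%N ->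
  exists T, forall x y : seq bool, size x = (d * r)%N -> size y = (d * r)%N -> x != y ->
    (count (fun a => address r d T a x == address r d T a y) (iota 0 n) < d)%N.
Proof.
move=> r_gt0 le_n; have [F [bit [dec [cardF bitD bit_inj bit_dec]]]] := binary_field r_gt0.
pose alpha a : F := nth 0 (enum F) a.
pose T a j b w := bit (dec w * alpha a ^+ j) b.
exists T => x y sz_x sz_y neq_xy.
pose coef (x : seq bool) j : F := dec (block r j x).
have bit0 b : bit 0 b = false.
  by apply/negbTE; have := bitD 0 0 b; rewrite addr0; case: (bit 0 b).
have addressE a w b : (b < r)%N ->
    nth false (address r d T a w) b = bit (\poly_(j < d) coef w j).[alpha a] b.
  move=> lt_b; rewrite (nth_map 0%N) ?size_iota // nth_iota // add0n.
  rewrite horner_poly -(big_mkord xpredT (fun j => coef w j * alpha a ^+ j)).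
  rewrite /index_iota subn0; elim: (iota 0 d) => [|j s IH]; first by rewrite big_nil bit0.
  by rewrite big_cons bitD -IH.
(* A row where x and y select the same point gives a root of the difference polynomial, which is
   nonzero because its blocks determine a word. *)
pose p := \poly_(j < d) (coef x j - coef y j).
have pE : p = \poly_(j < d) coef x j - \poly_(j < d) coef y j.
  by apply/polyP => j; rewrite coefB !coef_poly; case: ifP; rewrite ?subr0.
have p_neq0 : p != 0.
  apply: contraNneq neq_xy => p0.
  have eq_coef j : (j < d)%N -> coef x j = coef y j.
    move=> lt_j; apply/eqP; rewrite -subr_eq0.
    by have := coef_poly d (fun j => coef x j - coef y j) j; rewrite lt_j -/p p0 coef0 => <-.
  apply/eqP/(@eq_from_nth _ false); first by rewrite sz_x.
  move=> m; rewrite sz_x => lt_m.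
  have lt_i : (m %% r < r)%N by rewrite ltn_mod.
  have lt_j : (m %/ r < d)%N by rewrite ltn_divLR.
  rewrite (divn_eq m r) -!nth_block // -!bit_dec //.
  by congr bit; exact: eq_coef.
pose P a := address r d T a x == address r d T a y; rewrite -[count _ _]/(count P (iota 0 n)).
have lt_card a : a \in iota 0 n -> (a < size (enum F))%N.
  by rewrite mem_iota add0n -cardE cardF => /leq_trans; apply.
rewrite -size_filter -(size_map alpha).
apply: leq_trans (size_poly d (fun j => coef x j - coef y j)).
apply: max_poly_roots => //.
- rewrite all_map; apply/allP => a; rewrite mem_filter => /andP[/eqP eq_a _] /=.
  rewrite -/p /root pE hornerD hornerN subr_eq0; apply/eqP/bit_inj => b lt_b.
  by rewrite -!addressE // eq_a.
- rewrite map_inj_in_uniq ?filter_uniq ?iota_uniq // => a a'.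
  rewrite !mem_filter => /andP[_ /lt_card lt_a] /andP[_ /lt_card lt_a'] /eqP.
  by rewrite nth_uniq ?enum_uniq // => /eqP.
Qed.

End Design.

(** * From distinguishing to predicting *)

Lemma exists_above_average (P : finType) (A : P -> nat) B :
  0 < #|P| -> B * #|P| <= \sum_p A p -> exists p, B <= A p.
Proof.
move=> P_gt0 le_sum; apply/existsP; apply: contraLR le_sum => /existsPn lt_B.
have : \sum_p (A p).+1 <= \sum_(p : P) B.
  by apply: leq_sum => p _; have := lt_B p; rewrite -ltnNge.
under eq_bigr do rewrite -addn1.
by rewrite big_split /= !sum_nat_const muln1 -ltnNge [B * _]mulnC; apply: leq_trans; rewrite -addn1 leq_add2l.
Qed.

Lemma card_sum_bool (T : finType) (p : T -> bool) : #|[pred x | p x]| = \sum_x p x.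
Proof. by rewrite -sum1_card big_mkcond /=; apply: eq_bigr => x _; rewrite inE; case: (p x). Qed.

Section Hybrid.
Variables (n : nat) (V I : finType) (pos : I -> 'I_n -> V).
Variables (f : n.-tuple bool -> bool) (D : {ffun I -> bool} -> bool).

Notation seeds := {ffun 'I_n * V -> bool}.
Notation outputs := {ffun I -> bool}.

Definition select (z : seeds) (i : I) : n.-tuple bool :=
  [tuple z (a, pos i a) | a < n].

Definition override (z : seeds) (i : I) (x : n.-tuple bool) : seeds :=
  [ffun q => if q.2 == pos i q.1 then tnth x q.1 else z q].

Definition hybrid (j : nat) (z : seeds) (y : outputs) : outputs :=
  [ffun i => if enum_rank i < j then f (select z i) else y i].

Definition flip_at (i0 : I) (y : outputs) : outputs :=
  [ffun i => if i == i0 then ~~ y i else y i].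

(** [D] will reject all generator outputs, so its acceptance is taken as a sign that the bit [y i0]
    is wrong, and the guess is then flipped. *)
Definition correct (i0 : I) (z : seeds) (y : outputs) : bool :=
  y i0 (+) D (hybrid (enum_rank i0) z y) == f (select z i0).

Definition accepted (j : nat) : nat :=
  \sum_(q : seeds * outputs) D (hybrid j q.1 q.2).

Lemma flip_atK i0 : involutive (flip_at i0).
Proof. by move=> y; apply/ffunP => i; rewrite !ffunE; case: eqP => // _; exact: negbK. Qed.

Lemma select_override z i x : select (override z i x) i = x.
Proof. by apply: eq_from_tnth => a; rewrite tnth_mktuple ffunE /= eqxx. Qed.

Lemma overrideK z i x : override (override z i x) i (select z i) = z.
Proof.
apply/ffunP => -[a v]; rewrite !ffunE /=.
by case: eqP => [->|//]; rewrite tnth_mktuple.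
Qed.

Lemma hybrid_eq i0 z (y : outputs) : y i0 = f (select z i0) ->
  hybrid (enum_rank i0).+1 z y = hybrid (enum_rank i0) z y.
Proof.
move=> y0; apply/ffunP => i; rewrite !ffunE ltnS leq_eqVlt.
case: eqP => //= /val_inj/enum_rank_inj -> ; by rewrite ltnn y0.
Qed.

Lemma hybrid_flip i0 z y :
  hybrid (enum_rank i0).+1 z (flip_at i0 y) = hybrid (enum_rank i0).+1 z y.
Proof.
apply/ffunP => i; rewrite !ffunE; case: ltnP => // lt_i.
by case: eqP lt_i => // ->; rewrite ltnn.
Qed.

(** Of [y] and its flip, exactly one carries the true bit at [i0]. There the guess is right iff [D]
    rejects, on the other iff [D] accepts, and the next hybrid equals the current one with the true
    bit. *)
Lemma correct_flip i0 z y :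
  correct i0 z y + correct i0 z (flip_at i0 y) + (D (hybrid (enum_rank i0).+1 z y)).*2 =
  1 + (D (hybrid (enum_rank i0) z y) + D (hybrid (enum_rank i0) z (flip_at i0 y))).
Proof.
have y'0 : flip_at i0 y i0 = ~~ y i0 by rewrite ffunE eqxx.
rewrite /correct y'0; have [y0|y0] := eqVneq (y i0) (f (select z i0)).
  rewrite (hybrid_eq y0) -y0.
  by case: (y i0); case: (D _); case: (D _).
have {}y'0 : flip_at i0 y i0 = f (select z i0).
  by rewrite y'0; move: y0; case: (y i0); case: (f _).
rewrite -(hybrid_flip i0 z y) (hybrid_eq y'0).
by move: y0; case: (y i0); case: (f _) => //; case: (D _); case: (D _).
Qed.

(** Summing over the pairing by [flip_at]: the excess of correct guesses over one half is the fall
    in acceptance between consecutive hybrids. *)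
Lemma correct_advantage i0 :
  (\sum_(q : seeds * outputs) correct i0 q.1 q.2).*2 + (accepted (enum_rank i0).+1).*2 =
  #|{: seeds * outputs}| + (accepted (enum_rank i0)).*2.
Proof.
have flipE (F : seeds * outputs -> nat) :
    \sum_q F q = \sum_(q : seeds * outputs) F (q.1, flip_at i0 q.2).
  rewrite (reindex_inj (h := fun q : seeds * outputs => (q.1, flip_at i0 q.2))) //.
  by apply: (can_inj (g := fun q => (q.1, flip_at i0 q.2))) => -[z y] /=; rewrite flip_atK.
have double F : (\sum_(q : seeds * outputs) F q).*2 =
    \sum_(q : seeds * outputs) (F q + F (q.1, flip_at i0 q.2)).
  by rewrite big_split /= -flipE addnn.
have -> : #|{: seeds * outputs}| = \sum_(q : seeds * outputs) 1 by rewrite sum1_card.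
rewrite !double -!big_split /=; apply: eq_bigr => q _.
by rewrite hybrid_flip addnn correct_flip.
Qed.

(** Telescoping: acceptance is at least a quarter on random outputs and zero on generator outputs,
    so one of the [#|I|] steps loses at least the average. *)
Lemma accepted_drop :
  0 < #|I| -> (forall z, ~~ D [ffun i => f (select z i)]) ->
  #|{: outputs}| <= 4 * #|[pred y | D y]| ->
  exists i0 : I, 4 * #|I| * accepted (enum_rank i0).+1 + #|{: seeds * outputs}|
    <= 4 * #|I| * accepted (enum_rank i0).
Proof.
move=> I_gt0 D_gen D_dense; apply/existsP; apply: contraT => /existsPn no_drop.
set L := #|I| in I_gt0 no_drop *; set Q := #|_| in no_drop.
have step j : j <= L -> 4 * L * accepted 0 + j <= 4 * L * accepted j + j * Q.
  elim: j => [_|j IH lt_j]; first by rewrite mul0n !addn0.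
  have := no_drop (enum_val (Ordinal lt_j)); rewrite enum_valK /= -ltnNge => lt_q.
  by have := IH (ltnW lt_j); rewrite mulSn; lia.
have acc0 : Q <= 4 * accepted 0.
  rewrite /accepted -(pair_bigA _ (fun z y => D (hybrid 0 z y) : nat)) /=.
  have hyb0 z y : hybrid 0 z y = y by apply/ffunP => i; rewrite ffunE ltn0.
  under eq_bigr do under eq_bigr do rewrite hyb0.
  rewrite sum_nat_const /Q card_prod.
  by rewrite -card_sum_bool mulnCA leq_mul2l D_dense orbT.
have accL : accepted L = 0.
  rewrite /accepted big1 // => q _; have := D_gen q.1.
  suff -> : hybrid L q.1 q.2 = [ffun i => f (select q.1 i)] by case: (D _).
  by apply/ffunP => i; rewrite !ffunE ltn_ord.
have := step L (leqnn L); rewrite accL; nia.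
Qed.

(** Overwriting the design set of [i0] by a uniform x leaves the seed uniform, so averaging fixes a
    seed and random bits. The bound is an agreement of at least 1/2 + 1/(4 L) with L = [#|I|]. *)
Lemma predictor_exists :
  0 < #|I| -> (forall z, ~~ D [ffun i => f (select z i)]) ->
  #|{: outputs}| <= 4 * #|[pred y | D y]| ->
  exists (i0 : I) z (y : outputs), (2 * #|I|).+1 * 2 ^ n <=
    4 * #|I| * #|[pred x | y i0 (+) D (hybrid (enum_rank i0) (override z i0 x) y) == f x]|.
Proof.
move=> I_gt0 D_gen D_dense.
have [i0 drop] := accepted_drop I_gt0 D_gen D_dense; exists i0.
have adv := correct_advantage i0.
pose agree z (y : outputs) := #|[pred x | y i0 (+) D (hybrid (enum_rank i0) (override z i0 x) y) == f x]|.
suff [[z y] le_zy] : exists q : seeds * outputs,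
    (2 * #|I|).+1 * 2 ^ n <= 4 * #|I| * agree q.1 q.2 by exists z, y.
apply: exists_above_average.
  by apply/card_gt0P; exists ([ffun=> false], [ffun=> false]).
suff E : \sum_(q : seeds * outputs) agree q.1 q.2 =
         2 ^ n * \sum_(q : seeds * outputs) correct i0 q.1 q.2.
  rewrite -big_distrr /= E.
  have : (2 * #|I|).+1 * #|{: seeds * outputs}| <=
      4 * #|I| * \sum_(q : seeds * outputs) correct i0 q.1 q.2 by nia.
  by move=> le_K; rewrite [_ * 2 ^ n]mulnC -mulnA [X in _ <= X]mulnCA leq_mul2l le_K orbT.
have agreeE z y : agree z y = \sum_(x : n.-tuple bool) correct i0 (override z i0 x) y.
  rewrite [LHS]card_sum_bool; apply: eq_bigr => x _.
  by rewrite /correct select_override.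
have swapE (F : seeds -> nat) :
    \sum_(z : seeds) \sum_(x : n.-tuple bool) F (override z i0 x) = 2 ^ n * \sum_z F z.
  rewrite pair_bigA /=.
  (* This involution exchanges x with the bits that it overwrites and serves as the change of
     variables. *)
  pose tau (q : seeds * n.-tuple bool) := (override q.1 i0 q.2, select q.1 i0).
  have tauK : involutive tau.
    by case=> z x; rewrite /tau /= overrideK select_override.
  rewrite (reindex_inj (inv_inj tauK)) /=.
  under eq_bigr do rewrite overrideK.
  rewrite -(pair_bigA _ (fun z (x : n.-tuple bool) => F z)) /=.
  under eq_bigr do rewrite sum_nat_const card_tuple card_bool.
  by rewrite -big_distrr.
rewrite -(pair_bigA _ agree) -(pair_bigA _ (fun z y => correct i0 z y : nat)) /=.
under eq_bigr do under eq_bigr do rewrite agreeE.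
rewrite exchange_big [in RHS]exchange_big /= big_distrr /=; apply: eq_bigr => y _.
exact: (swapE (fun z => correct i0 z y : nat)).
Qed.
End Hybrid.

(** * Counting functions with small circuits *)

(* A gate without arguments costs no wire, so the number of gates is not bounded
   by the number of wires; such gates are replaced by two extra inputs carrying
   the constants. *)
Lemma normalize_gates O n gs : wf_gates n gs -> exists gs' (rho : nat -> nat),
  [/\ wire_count gs' = wire_count gs,
      all (fun g => 0 < size (args g)) gs' /\
      (forall p : pred gate_kind, all (fun g => p (kind g)) gs ->
        all (fun g => p (kind g)) gs'),
      all (fun j => j < n + 2 + size gs') (fan_in gs'),
      forall j, j < n + size gs -> rho j < n + 2 + size gs'
    & forall x, size x = n -> forall j, j < n + size gs ->
        nth false (propagate false (gate_sem O) (x ++ [:: true; false]) gs') (rho j) =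
        nth false (propagate false (gate_sem O) x gs) j].
Proof.
elim/last_ind: gs => [_|gs g IH /wf_gates_rcons[wf lt_g]].
  exists [::], id; split=> // [j|x sz_x j]; rewrite addn0 => lt_j; first by lia.
  by rewrite /= nth_cat sz_x lt_j.
have [gs' [rho [wi [ne kin] fan rng val]]] := IH wf.
have [args0|args_n0] := eqVneq (args g) [::].
  pose b := gate_sem O (kind g) [::].
  exists gs', (fun j => if j < n + size gs then rho j else if b then n else n.+1).
  split=> //.
  - by rewrite wi /wire_count map_rcons sumn_rcons args0 addn0.
  - by split=> // p; rewrite all_rcons => /andP[_ /kin].
  - by move=> j _; case: ifP => [/rng//|_]; case: b; lia.
  - move=> x sz_x j; rewrite size_rcons addnS ltnS => le_j.
    rewrite propagate_rcons nth_rcons size_propagate sz_x.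
    case: ltnP => lt_j; first exact: val.
    have -> : j = n + size gs by lia.
    rewrite eqxx args0 /= -/b nth_propagate ?size_cat ?sz_x /=; last by case: b; lia.
    by rewrite nth_cat sz_x; case: b; rewrite ltnNge ?leqnSn ?leqnn /= ?subnn ?subSnn.
exists (rcons gs' (Gate (kind g) (map rho (args g)))),
  (fun j => if j < n + size gs then rho j else n + 2 + size gs').
have lt_rho j : j \in args g -> rho j < n + 2 + size gs' by move=> /(allP lt_g)/rng.
split.
- by rewrite /wire_count !map_rcons !sumn_rcons -!/(wire_count _) wi /= size_map.
- split=> [|p]; rewrite !all_rcons /= ?size_map ?ne ?andbT.
    by case: (args g) args_n0.
  by case/andP => -> /kin.
- rewrite fan_in_rcons all_cat size_rcons; apply/andP; split.
    by apply: sub_all fan => j /=; lia.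
  by rewrite /= all_map; apply/allP => j /lt_rho /=; lia.
- by move=> j _; rewrite size_rcons; case: ifP => [/rng|_]; lia.
- move=> x sz_x j; rewrite size_rcons addnS ltnS => le_j.
  rewrite !propagate_rcons !nth_rcons !size_propagate size_cat sz_x /=.
  case: (ltnP j (n + size gs)) => lt_j; first by rewrite rng // val.
  have -> : j = n + size gs by lia.
  rewrite ltnn !eqxx -map_comp; congr (gate_sem O _ _).
  by apply/eq_in_map => i /(allP lt_g) lt_i /=; rewrite val.
Qed.

(** * Circuits encoded as words over a finite alphabet *)

Definition kind_code (k : gate_kind) : nat :=
  match k with
  | GAnd => 0 | GOr => 1 | GNot => 2 | GMaj => 3 | GOracle => 4 | GMod q => q + 5
  end.

Definition kind_decode (i : nat) : gate_kind :=
  match i with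
  | 0 => GAnd | 1 => GOr | 2 => GNot | 3 => GMaj | 4 => GOracle | q.+4.+1 => GMod q
  end.

Lemma kind_codeK : cancel kind_code kind_decode.
Proof. by case=> //= q; rewrite addnC. Qed.

(* Circuits as words: token 0 does nothing, tokens 1..K emit a gate reading the
   pending nodes, and larger tokens add a pending node. *)
Section Tokens.
Variables (O : language) (K : nat).

Definition token_step (st : seq bool * seq nat) (t : nat) : seq bool * seq nat :=
  if t is t'.+1 then
    if t' < K then
      (rcons st.1 (gate_sem O (kind_decode t') [seq nth false st.1 j | j <- st.2]), [::])
    else (st.1, rcons st.2 (t' - K))
  else st.

(** The two additional nodes are the constants of [normalize_gates]; the output is the pending node
    left once the word is read. *)
Definition token_eval (ts : seq nat) (x : seq bool) : bool :=
  let st := foldl token_step (x ++ [:: true; false], [::]) ts in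
  nth false st.1 (head 0 st.2).

Lemma fan_in_cons g gs : fan_in (g :: gs) = args g ++ fan_in gs. Proof. by []. Qed.

Definition gate_tokens (g : gate) : seq nat :=
  rcons [seq (j + K).+1 | j <- args g] (kind_code (kind g)).+1.

Lemma token_push vs ps js :
  foldl token_step (vs, ps) [seq (j + K).+1 | j <- js] = (vs, ps ++ js).
Proof.
elim: js ps => [|j js IH] ps /=; first by rewrite cats0.
by rewrite ltnNge leq_addl /= addnK IH cat_rcons.
Qed.

Lemma token_gates vs gs :
  all (fun g => kind_code (kind g) < K) gs ->
  foldl token_step (vs, [::]) (flatten (map gate_tokens gs)) =
  (propagate false (gate_sem O) vs gs, [::]).
Proof.
elim: gs vs => //= g gs IH vs /andP[lt_g lt_gs].
by rewrite foldl_cat foldl_rcons token_push /= lt_g kind_codeK IH.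
Qed.

Lemma token_nop st m : foldl token_step st (nseq m 0) = st.
Proof. by elim: m. Qed.

End Tokens.

(** Bounds all admissible moduli, so that finitely many gate codes suffice. *)
Definition modulus_cap (C : circuit_class) (u : consts) : nat :=
  maxn (if C is AC0p p then p else 0) (modulus_bound u).

Lemma allowed_code C u k m : allowed C u k m -> kind_code k < modulus_cap C u + 6.
Proof.
rewrite /allowed /gate_allowed /modulus_cap; case: k => [||| q||] //=; try by lia.
by case: C => [|p||||a|] //=; lia.
Qed.

(** After normalization there are at most s gates. One token per wire, one per gate and one for the
    output make 2s + 1, and token 0 pads all words to this length. *)
Lemma card_has_circuit C u n s :
  #|[pred g : {ffun n.-tuple bool -> bool} | `[< has_circuit C u s g >]]|
    <= (modulus_cap C u + n + s + 9) ^ (2 * s).+1.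
Proof.
set K := modulus_cap C u + 6; set A := modulus_cap C u + n + s + 9.
pose dec (w : (2 * s).+1.-tuple 'I_A) : {ffun n.-tuple bool -> bool} :=
  [ffun x : n.-tuple bool => token_eval pred0 K (map val w) x].
have -> : A ^ (2 * s).+1 = #|{: (2 * s).+1.-tuple 'I_A}| by rewrite card_tuple card_ord.
apply: leq_trans (leq_image_card dec predT); apply: subset_leq_card. apply/fintype.subsetP => g.
move=> /asboolP[c []]; rewrite circuit_ofE => /and4P[/wf_circuitP[wf lt_o] le_s _ al] cE.
have [gs' [rho [wi [ne kin] fan rng val]]] := normalize_gates pred0 wf.
have kin' : all (fun g => kind_code (kind g) < K) gs'.
  by apply: (kin (fun k => kind_code k < K)); apply: sub_all al => g' /allowed_code.
have le_gs' : size gs' <= wire_count gs'.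
  rewrite /wire_count; elim: gs' ne {wi kin fan rng val kin'} => //= g' gs' IH /andP[].
  by move=> g'_gt0 /IH; lia.
have le_wi : wire_count gs' <= s by rewrite wi -wiresE.
set ts := rcons (flatten (map (gate_tokens K) gs')) (rho (output c) + K).+1.
have sz_ts : size ts <= (2 * s).+1.
  rewrite size_rcons ltnS.
  suff -> : size (flatten (map (gate_tokens K) gs')) = wire_count gs' + size gs' by lia.
  rewrite /wire_count; elim: (gs') => //= g' l IH.
  by rewrite size_cat IH size_rcons size_map; lia.
have lt_ts : all (fun t => t < A) ts.
  have lt_node j : j < n + 2 + size gs' -> (j + K).+1 < A by rewrite /K /A; lia.
  rewrite all_rcons lt_node ?rng //=.
  have {}lt_node : all (fun j => (j + K).+1 < A) (fan_in gs') by apply: sub_all fan.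
  elim: (gs') lt_node kin' => //= g' l IH; rewrite fan_in_cons !all_cat.
  move=> /andP[lt_g' lt_l] /andP[kin_g' /IH ->//].
  rewrite all_rcons all_map andbT lt_g' andbT; move: kin_g'; rewrite /K /A; lia.
pose w := nseq ((2 * s).+1 - size ts) 0 ++ ts.
have sz_w : size w == (2 * s).+1 by rewrite size_cat size_nseq subnK.
have lt_w : all (fun t => t < A) w.
  by rewrite all_cat lt_ts andbT all_nseq /A addnS orbT.
pose w' := [seq inord t : 'I_A.-1.+1 | t <- w].
have A_gt0 : A.-1.+1 = A by rewrite /A addnS.
pose w'' := [seq cast_ord A_gt0 t | t <- w'].
have sz_w'' : size w'' == (2 * s).+1 by rewrite !size_map.
have valE : map \val w'' = w.
  rewrite -!map_comp -[RHS]map_id; apply/eq_in_map => t /(allP lt_w) lt_t /=.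
  by rewrite inordK // A_gt0.
apply/fintype.imageP; exists (Tuple sz_w'') => //; apply/ffunP => x; rewrite ffunE /= valE.
rewrite /token_eval foldl_cat token_nop foldl_rcons token_gates //=.
rewrite ltnNge leq_addl /= addnK val ?size_tuple //.
by rewrite -cE.
Qed.

(** The induction starts at 14: 112^2 <= 2^14, while 104^2 > 2^13. *)
Lemma quadratic_below_exp n : 14 <= n -> (8 * n) ^ 2 <= 2 ^ n.
Proof.
elim: n => // n IH; rewrite leq_eqVlt => /orP[/eqP <- //|]; rewrite ltnS => le_n.
have := IH le_n; rewrite [2 ^ n.+1]expnS -!mulnn; nia.
Qed.

(** The token alphabet has at most 2^n letters, so there are at most 2^(n (2s + 1)) words; as s and
    8n are both at most 2^(n/2), the exponent plus one is at most 2^n. *)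
Lemma few_easy_functions C u n s :
  14 <= n -> modulus_cap C u + 9 <= n -> s ^ 2 <= 2 ^ n ->
  2 * #|[pred g : {ffun n.-tuple bool -> bool} | `[< has_circuit C u s g >]]|
    <= 2 ^ 2 ^ n.
Proof.
move=> le14 le_cap le_s.
have le_8n := quadratic_below_exp le14.
have le_ns : 8 * n * s <= 2 ^ n.
  by rewrite -leq_sqr expnMn [X in _ <= X]expnS expn1 leq_mul.
have le_n : 8 * n <= 2 ^ n by apply: leq_trans le_8n; rewrite -[X in X <= _]expn1 leq_pexp2l; lia.
apply: leq_trans (leq_mul (leqnn 2) (card_has_circuit C u n s)) _.
apply: leq_trans (_ : 2 * (2 ^ n) ^ (2 * s).+1 <= _).
  rewrite leq_mul2l /= leq_exp2r //; nia.
by rewrite -expnM -expnS leq_exp2l //; nia.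
Qed.

(** * The predictor as an oracle circuit *)

Lemma bin_val_rcons s b : bin_val (rcons s b) = (bin_val s).*2 + b.
Proof. exact: foldl_rcons. Qed.

Lemma bin_val_lt s : bin_val s < 2 ^ size s.
Proof.
elim/last_ind: s => // s b IH; rewrite bin_val_rcons size_rcons expnS.
by case: b; lia.
Qed.

Lemma bin_val_inj s t : size s = size t -> bin_val s = bin_val t -> s = t.
Proof.
elim/last_ind: s t => [|s b IH] t; case/lastP: t => [|t b']; rewrite ?size_rcons //.
move=> [eq_sz]; rewrite !bin_val_rcons => eq_val.
have eq_b : b = b' by case: b b' eq_val => -[] //; lia.
by subst b'; rewrite (IH t) //; lia.
Qed.

Definition bin_word (l k : nat) : l.-tuple bool :=
  odflt [tuple of nseq l false] [pick i : l.-tuple bool | bin_val i == k].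

Lemma bin_valK l (i : l.-tuple bool) : bin_word l (bin_val i) = i.
Proof.
rewrite /bin_word; case: pickP => [j /eqP /bin_val_inj eq_ji|/(_ i)]; last by rewrite eqxx.
by apply/val_inj/eq_ji; rewrite !size_tuple.
Qed.

Lemma fn_mkseq l (y : {ffun l.-tuple bool -> bool}) :
  fn l [seq y (bin_word l k) | k <- iota 0 (2 ^ l)] = y.
Proof.
apply/ffunP => i; have := bin_val_lt i; rewrite size_tuple => lt_i.
by rewrite ffunE (nth_map 0) ?size_iota // nth_iota // add0n bin_valK.
Qed.

Lemma size_address r d T a x : size (address r d T a x) == r.
Proof. by rewrite size_map size_iota. Qed.

Section PredictorCircuit.
Variables (r d n : nat) (T : nat -> nat -> nat -> seq bool -> bool) (f : language).
Notation l := (d * r).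
Notation words := (l.-tuple bool).

Definition address_tuple (x : words) (a : 'I_n) : r.-tuple bool :=
  Tuple (size_address r d T a x).

Definition seed_fun (z : {ffun 'I_n * r.-tuple bool -> bool}) (a : nat) (w : seq bool) : bool :=
  if insub a is Some a' then
    if insub w is Some w' then z (a', w') else false
  else false.

Lemma seed_funE z (a : 'I_n) (w : r.-tuple bool) : seed_fun z a w = z (a, w).
Proof. by rewrite /seed_fun !valK. Qed.

Lemma select_nw z (x : words) :
  select address_tuple z x = nw_input r d T n (seed_fun z) x :> seq bool.
Proof.
rewrite /= /nw_input -val_enum_ord -map_comp; apply: eq_map => a /=.
by rewrite -(seed_funE z a (address_tuple x a)).
Qed.

Definition common (x0 x : words) : seq nat :=
  [seq a <- iota 0 n | address r d T a x == address r d T a x0].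

Definition overridden_input z (x0 x : words) (w : seq bool) : seq bool :=
  [seq if a \in common x0 x then nth false w (index a (common x0 x))
       else seed_fun z a (address r d T a x) | a <- iota 0 n].

(** Locality: with the seed fixed, [t] matters only through the rows shared with [x0], which a
    design keeps below d for x different from [x0]. *)
Lemma select_overridden z (x0 x : words) (t : n.-tuple bool) :
  select address_tuple (override address_tuple z x0 t) x =
  overridden_input z x0 x [seq nth false t a | a <- common x0 x] :> seq bool.
Proof.
apply: (@eq_from_nth _ false) => [|j]; first by rewrite size_tuple size_map size_iota.
rewrite size_tuple => lt_j; pose a := Ordinal lt_j.
rewrite -[LHS](tnth_nth false _ a) tnth_mktuple (nth_map 0) ?size_iota // nth_iota // add0n.
rewrite -[j]/(nat_of_ord a).
rewrite ffunE /= -val_eqE /=; case: ifP => [eq_a|neq_a].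
  have a_common : nat_of_ord a \in common x0 x.
    by rewrite mem_filter eq_a mem_iota add0n ltn_ord.
  by rewrite a_common (nth_map 0) ?index_mem // nth_index // (tnth_nth false).
by rewrite mem_filter neq_a /= -(seed_funE z a (address_tuple x a)).
Qed.

(* The word preceding [x0] is answered by f on the overridden seed, which
   depends on few bits of the input; the other words by the fixed bits [y]. *)
Definition hybrid_tree z (y : {ffun words -> bool}) (x0 x : words) : tree :=
  if enum_rank x < enum_rank x0 then
    table true [seq Leaf a | a <- common x0 x] (fun w => f (overridden_input z x0 x w))
  else table true [::] (fun _ => y x).

Lemma hybrid_tree_value O z y (x0 x : words) (t : n.-tuple bool) :
  tree_label (gate_sem O) (nth false t) (hybrid_tree z y x0 x) =
  hybrid address_tuple (fun s => f s) (enum_rank x0) (override address_tuple z x0 t) y x.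
Proof.
rewrite ffunE /hybrid_tree; case: ifP => _; last by rewrite table_value.
by rewrite table_value select_overridden -map_comp.
Qed.

Lemma hybrid_tree_leaves z y x0 x : all (fun j => j < n) (leaves (hybrid_tree z y x0 x)).
Proof.
rewrite /hybrid_tree; case: ifP => _; apply: table_leaves => //.
rewrite all_map; apply/allP => a.
by rewrite mem_filter mem_iota add0n /= andbT => /andP[].
Qed.

Lemma hybrid_tree_all z y x0 x : tree_all (basic_gate true) (hybrid_tree z y x0 x).
Proof.
by rewrite /hybrid_tree; case: ifP => _; apply: table_all => //; rewrite all_map; apply/allP.
Qed.

Lemma hybrid_tree_level z y x0 x : tree_level (hybrid_tree z y x0 x) <= 3.
Proof.
rewrite /hybrid_tree; case: ifP => _; apply: (table_level _ _ (D := 0)) => //.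
by rewrite all_map; apply/allP.
Qed.

Lemma hybrid_tree_wires z y x0 x :
  (x != x0 -> size (common x0 x) <= d) ->
  tree_wires (hybrid_tree z y x0 x) <= 4 ^ d * 7.
Proof.
move=> le_d; rewrite /hybrid_tree; case: ifP => [lt_x|_].
  apply: leq_trans (table_wires _ _ (w := 0) _) _.
    by rewrite all_map; apply/allP.
  rewrite size_map leq_mul // leq_pexp2l // le_d //.
  by apply: contraTneq lt_x => ->; rewrite ltnn.
by apply: leq_trans (table_wires _ _ (w := 0) _) _ => //=; rewrite leq_mul // expn_gt0.
Qed.

End PredictorCircuit.

Lemma has_circuit_ext C u n s (g g' : n.-tuple bool -> bool) :
  g =1 g' -> has_circuit C u s g -> has_circuit C u s g'.
Proof. by move=> eq_g [c [c_ok cE]]; exists c; split=> // x; rewrite cE. Qed.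

(** Every generator output has a circuit of the size against which [P] is useful, so membership in
    [P] is the distinguisher, and the predictor becomes one oracle query. *)
Lemma reduction_at_length C u v k n r d s' (f : language) (P : property)
    (O : language) (neg : bool) :
  0 < r -> n <= 2 ^ r ->
  (unbounded_fanin C -> depth_bound u + 9 <= depth_bound v) ->
  modulus_bound u <= modulus_bound v ->
  (n ^ k).+1 * (4 ^ r * (7 + 2 * (4 ^ d * (7 + 2 * (4 ^ r * 7))))).+1 <= s' ->
  (if C is NC1 a then (n ^ k) ^ a * 2 ^ (6 * r + 3 * d) <= s' ^ a else true) ->
  has_circuit C u (n ^ k) (fun x : n.-tuple bool => f x) ->
  (forall g, g \in P (d * r) -> ~ has_circuit C v s' g) ->
  #|{: {ffun (d * r).-tuple bool -> bool}}| <= 4 * #|P (d * r)| ->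
  (forall y, size y = 2 ^ (d * r) -> neg (+) O y = (fn (d * r) y \in P (d * r))) ->
  exists c, [/\ oracle_circuit_of AC0 (Consts 5 0) n
                  (2 ^ (d * r) * (4 ^ d * 7).+1 + 1) c,
    nonadaptive n c &
    (2 * 2 ^ (d * r)).+1 * 2 ^ n <=
      4 * 2 ^ (d * r) * #|[pred x : n.-tuple bool | Defs.eval O c x == f x]|].
Proof.
move=> r_gt0 le_n le_dep le_mod le_s' le_nc1 f_easy useful dense OE.
have [T designT] := design_exists d r_gt0 le_n.
set l := d * r.
pose D (y : {ffun l.-tuple bool -> bool}) := y \in P l.
pose f' (x : n.-tuple bool) := f x.
have cardI : #|{: l.-tuple bool}| = 2 ^ l by rewrite card_tuple card_bool.
have [|||i0 [z [y agree]]] := @predictor_exists n (r.-tuple bool : finType)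
    (l.-tuple bool : finType) (@address_tuple r d n T) f' D.
- by rewrite cardI expn_gt0.
- move=> z; apply/negP => /useful; apply.
  apply: has_circuit_ext (nw_circuit T (seed_fun z) le_dep le_mod le_s' le_nc1 f_easy).
  by move=> x; rewrite ffunE /f' select_nw.
- exact: dense.
(* The trees follow the lexicographic order of words, so that the oracle reads a truth table. *)
pose ts := [seq hybrid_tree T f z y i0 (bin_word l m) | m <- iota 0 (2 ^ l)].
(* The XOR of the predictor with the fixed bit [y i0] merges with [neg] into one optional negation;
   3 is the depth of a DNF with negated literals. *)
have [|||c [c_ok c_na cE]] := @oracle_query n ts (neg (+) y i0) 3.
- by rewrite all_map; apply/allP => m _; exact: hybrid_tree_leaves.
- by rewrite all_map; apply/allP => m _; exact: hybrid_tree_all.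
- by rewrite all_map; apply/allP => m _; exact: hybrid_tree_level.
exists c; split=> //.
- case/and4P: c_ok => wf le_w sh al; apply/and4P; split=> //.
  apply: leq_trans le_w _; rewrite leq_add2r size_map size_iota mulnS leq_add2l.
  rewrite /ts -map_comp -[X in _ <= X * _](size_iota 0).
  apply: sumn_leq_const; apply/allP => m _ /=; apply: hybrid_tree_wires => neq_i0.
  by rewrite size_filter ltnW // designT ?size_tuple.
- rewrite -cardI; apply: leq_trans agree _; rewrite leq_mul2l; apply/orP; right.
  apply/subset_leq_card/fintype.subsetP => x; rewrite !inE => /eqP; rewrite -[f' x]/(f x) => <-.
  rewrite cE ?size_tuple // -map_comp.
  set q := map _ _.
  have qE : q = [seq hybrid (@address_tuple r d n T) f' (enum_rank i0)
      (override (@address_tuple r d n T) z i0 x) y (bin_word l m) | m <- iota 0 (2 ^ l)].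
    by apply: eq_map => m /=; exact: hybrid_tree_value.
  have sz_q : size q = 2 ^ l by rewrite size_map size_iota.
  by rewrite addbAC (OE _ sz_q) qE fn_mkseq addbC.
Qed.

(** * Asymptotics *)

Lemma near_ooP (P : nat -> Prop) :
  (\forall n \near \oo, P n)%classic <-> exists N, forall n, N <= n -> P n.
Proof. by split=> [[N _ H]|[N H]]; exists N. Qed.

Lemma leq_exp2_mono m n e : m <= n -> m ^ e <= n ^ e.
Proof. by case: e => // e; rewrite leq_exp2r. Qed.

(** With q = 2^r, a formula costs less than 50 4^d q^4 and n^k + 1 is at most 2 q^k; the constant
    100 4^d is absorbed by q^2, so the product stays below q^(k + 8). *)
Lemma nw_size_bound n k r d s :
  n <= 2 ^ r -> 100 * 4 ^ d <= n -> 2 ^ (r * (k + 8)) <= s ->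
  (n ^ k).+1 * (4 ^ r * (7 + 2 * (4 ^ d * (7 + 2 * (4 ^ r * 7))))).+1 <= s.
Proof.
move=> le_n le_d; apply: leq_trans.
rewrite expnM expnD; set q := 2 ^ r in le_n *.
have -> : 4 ^ r = q ^ 2 by rewrite /q -expnM mulnC expnM.
have q_gt0 : 0 < q by rewrite expn_gt0.
have d_gt0 : 0 < 4 ^ d by rewrite expn_gt0.
have le_k : n ^ k <= q ^ k by exact: leq_exp2_mono.
have qk_gt0 : 0 < q ^ k by rewrite expn_gt0 q_gt0.
rewrite [q ^ 8](expnM q 2 4); have q2_gt0 : 0 < q ^ 2 by rewrite expn_gt0 q_gt0.
have le_dq : 100 * 4 ^ d <= q ^ 2.
  by rewrite (leq_trans le_d) // (leq_trans le_n) // leq_pmulr.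
move: (4 ^ d) (q ^ 2) (q ^ k) (n ^ k) => B Q K m in d_gt0 le_dq q2_gt0 qk_gt0 le_k *.
have le1 : (Q * (7 + 2 * (B * (7 + 2 * (Q * 7))))).+1 <= 50 * B * (Q * Q).
  have := leq_mul d_gt0 q2_gt0; have := leq_mul d_gt0 (leqnn (Q * Q)).
  have := leq_mul q2_gt0 (leqnn Q); have := leq_mul (leqnn B) (leq_mul q2_gt0 (leqnn Q)).
  by nia.
apply: leq_trans (leq_mul (_ : m.+1 <= 2 * K) le1) _; first by lia.
have -> : 2 * K * (50 * B * (Q * Q)) = K * ((100 * B) * (Q * Q)) by nia.
rewrite leq_mul2l -[Q ^ 4]/(Q * (Q * (Q * Q))); apply/orP; right.
by apply: leq_trans (leq_mul le_dq (leqnn _)) _; rewrite leq_mul2l leq_pmull ?orbT.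
Qed.

(** The additional depth contributes a factor q^6 8^d with q = 2^r, and 8^d <= (4^d)^2 <= q^2; as a
    >= 1, this fits in (q^8)^a. *)
Lemma nw_depth_bound n k r d s a :
  0 < a -> n <= 2 ^ r -> 100 * 4 ^ d <= n -> 2 ^ (r * (k + 8)) <= s ->
  (n ^ k) ^ a * 2 ^ (6 * r + 3 * d) <= s ^ a.
Proof.
move=> a_gt0 le_n le_d le_s; apply: leq_trans (leq_exp2_mono a le_s).
rewrite [X in _ <= X ^ _]expnM [X in _ <= X ^ _]expnD expnMn leq_mul //; first by rewrite !leq_exp2_mono.
have q_gt0 : 0 < 2 ^ r by rewrite expn_gt0.
apply: leq_trans (_ : (2 ^ r) ^ 8 <= _); last first.
  by rewrite -[X in X <= _]expn1 leq_pexp2l // expn_gt0 q_gt0.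
rewrite expnD [6 * r]mulnC !expnM (expnD _ 6 2) mulnC [X in _ <= X]mulnC leq_mul //.
apply: leq_trans (_ : (4 ^ d) ^ 2 <= _).
  by rewrite -[X in _ <= X]expnM [d * 2]mulnC [X in _ <= X]expnM leq_exp2_mono.
by apply: leq_exp2_mono; apply: leq_trans le_n; apply: leq_trans le_d; rewrite leq_pmull.
Qed.

(** As 2 <= n, the factors (2n)^d and 2^(2d + 3) are at most n^(2d) and n^(2d + 3). *)
Lemma reduction_size_bound n r d :
  1 < n -> 2 ^ r <= 2 * n ->
  2 ^ (d * r) * (4 ^ d * 7).+1 + 1 <= n ^ (4 * d + 3) + (4 * d + 3).
Proof.
move=> n_gt1 le_q; apply: leq_add; last by rewrite addnS.
rewrite [d * r]mulnC expnM.
apply: leq_trans (leq_mul (leq_exp2_mono d le_q) (_ : _ <= 2 ^ (2 * d + 3))) _.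
  rewrite expnD expnM -[4]/(2 ^ 2) -[2 ^ 3]/8.
  by have : 0 < (2 ^ 2) ^ d; [rewrite expn_gt0|lia].
rewrite expnMn mulnAC -expnD mulnC.
have -> : n ^ (4 * d + 3) = n ^ d * n ^ (d + (2 * d + 3)) by rewrite -expnD; congr (_ ^ _); lia.
by rewrite leq_mul2l leq_exp2_mono ?orbT.
Qed.

Lemma oracle_AC0_mono u n s s' c :
  s <= s' -> oracle_circuit_of AC0 u n s c -> oracle_circuit_of AC0 u n s' c.
Proof.
move=> le_s /and4P[wf le_c sh al]; apply/and4P; split=> //.
exact: leq_trans le_c le_s.
Qed.

(** Serves the lengths below the threshold: a reduction has a circuit at every length, while
    approximation concerns large n. *)
Lemma trivial_circuit n e : exists c,
  oracle_circuit_of AC0 (Consts 5 0) n (n ^ e + e) c /\ nonadaptive n c.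
Proof.
exists (Circ [:: Gate GOr [::]] n); split; last exact: nonadaptive_single.
apply/and4P; split=> //.
- by apply/wf_circuitP; split=> [[]|] //=; rewrite addn1.
- by rewrite wiresE.
- by rewrite /= /depth /levels /= nth_rcons size_nseq ltnn eqxx big_nil.
Qed.

(** * Real-valued bounds and assembly of the reductions *)

Import Order.TTheory GRing.Theory Num.Theory.

Section Reals.
Local Open Scope ring_scope.

(** The advantage 1/(4 2^(dr)) is at least 1/(4 2^d n^d) because 2^r <= 2n. *)
Lemma agreement_fraction (R : realType) n r d (A : nat) :
  (0 < n)%N -> (2 ^ r <= 2 * n)%N ->
  ((2 * 2 ^ (d * r)).+1 * 2 ^ n <= 4 * 2 ^ (d * r) * A)%N ->
  1 - (1 / 2 - (1 / (4 * 2 ^+ d)) / n%:R ^+ d) <= A%:R / (2 ^ n)%:R :> R.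
Proof.
move=> n_gt0 le_q; rewrite mulnC [(d * r)%N]mulnC expnM.
set L := ((2 ^ r) ^ d)%N => le_A.
have L_gt0 : (0 < L%:R :> R) by rewrite ltr0n !expn_gt0.
have N_gt0 : (0 < (2 ^ n)%:R :> R) by rewrite ltr0n expn_gt0.
have le_L : L%:R <= 2 ^+ d * n%:R ^+ d :> R.
  by rewrite -exprMn -natrM natrX; apply: lerXn2r; rewrite ?nnegrE ?ler0n // ler_nat.
have n_gt0' : 0 < 2 ^+ d * n%:R ^+ d :> R by rewrite mulr_gt0 ?exprn_gt0 // ltr0n.
have le_kappa : (1 / (4 * 2 ^+ d)) / n%:R ^+ d <= 1 / (4 * L%:R) :> R.
  have p4 (x : R) : 0 < x -> 4 * x \is Num.pos by move=> x_gt0; rewrite posrE mulr_gt0.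
  by rewrite !div1r -invfM -mulrA lef_pV2 ?p4 // ler_pM2l.
have {}le_A : (2 * L%:R + 1) * (2 ^ n)%:R <= 4 * L%:R * A%:R :> R.
  by rewrite -!natrM natr1 -natrM ler_nat mulnC.
rewrite ler_pdivlMr //; apply: le_trans (_ : (1 / 2 + 1 / (4 * L%:R)) * (2 ^ n)%:R <= _).
  by rewrite ler_pM2r //; lra.
rewrite -(ler_pM2l (x := 4 * L%:R)) ?mulr_gt0 //; apply: le_trans le_A.
rewrite mulrA; rewrite le_eqVlt; apply/orP; left; apply/eqP; congr (_ * _); field.
by rewrite gt_eqF.
Qed.

Lemma exp_size_ge (R : realType) (delta : R) d r K :
  (K%:R <= delta * d%:R) -> (2 ^ (r * K) <= exp_size delta (d * r))%N.
Proof.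
move=> le_K; rewrite /exp_size truncn_ge_nat; last exact: powR_ge0.
rewrite natrX -powR_mulrn // ler_powR ?ler1n // natrM natrM mulrA mulrC.
by rewrite ler_wpM2r.
Qed.

Lemma exp_size_half_sqr (R : realType) n : (exp_size (1 / 2 : R) n ^ 2 <= 2 ^ n)%N.
Proof.
rewrite -(ler_nat R) !natrX.
have le_t : (exp_size (1 / 2 : R) n)%:R <= 2 `^ (1 / 2 * n%:R) :> R.
  by have /andP[] := truncn_itv (powR_ge0 (2 : R) (1 / 2 * n%:R)).
apply: le_trans (_ : (2 `^ (1 / 2 * n%:R)) ^+ 2 <= _).
  by apply: lerXn2r => //; rewrite nnegrE ?powR_ge0.
rewrite -powR_mulrn ?powR_ge0 // -powRrM -[X in _ <= X]powR_mulrn //.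
by rewrite ler_powR ?ler1n //; lra.
Qed.

(** Common to both targets; [neg] is set when the oracle decides the complement of [P]. *)
Lemma property_reduction (R : realType) C u v k d (S : nat -> nat) (f : language)
    (P : property) (O : language) (neg : bool) :
  typical C -> (0 < d)%N ->
  (forall r, 2 ^ (r * (k + 8)) <= S (d * r))%N ->
  (depth_bound u + 9 <= depth_bound v)%N -> (modulus_bound u <= modulus_bound v)%N ->
  in_class C u (fun n => n ^ k)%N f ->
  useful_against C v S P ->
  (exists N, forall l, (N <= l)%N ->
     (#|{: {ffun l.-tuple bool -> bool}}| <= 4 * #|P l|)%N) ->
  (forall l y, size y = (2 ^ l)%N -> neg (+) O y = (fn l y \in P l)) ->
  approx_tt_reduces AC0
    (fun n : nat => (1 / 2 - (1 / (4 * 2 ^+ d)) / n%:R ^+ d) : R) f O.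
Proof.
move=> typC d_gt0 S_ge le_dep le_mod /near_ooP[N1 f_easy] /near_ooP[N2 useful] [N3 dense] OE.
(* From [N] on, f has its circuits, [nw_size_bound] applies, and the generator length d r is large
   enough for usefulness and density. *)
pose N := maxn (maxn N1 (100 * 4 ^ d)) (2 ^ maxn N2 N3).
have red n : exists c, [/\ oracle_circuit_of AC0 (Consts 5 0) n (n ^ (4 * d + 3) + (4 * d + 3)) c,
    nonadaptive n c & (N <= n)%N ->
    1 - (1 / 2 - (1 / (4 * 2 ^+ d)) / n%:R ^+ d) <=
    #|[pred x : n.-tuple bool | Defs.eval O c x == f x]|%:R / (2 ^ n)%:R :> R].
  have [le_Nn|lt_nN] := leqP N n; last first.
    by have [c [c_ok c_na]] := trivial_circuit n (4 * d + 3); exists c.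
  move: le_Nn; rewrite !geq_max -andbA => /and3P[le_N1 le_d le_N23].
  have d4_gt0 : (0 < 4 ^ d)%N by rewrite expn_gt0.
  have n_gt1 : (1 < n)%N by lia.
  have [] := up_log_bounds (isT : (1 < 2)%N) n_gt1.
  set r := up_log 2 n => /andP[lt_r le_n].
  have r_gt0 : (0 < r)%N by rewrite up_log_gt0.
  have le_q : (2 ^ r <= 2 * n)%N by rewrite -(prednK r_gt0) expnS leq_mul2l ltnW.
  have le_r : (maxn N2 N3 <= d * r)%N.
    apply: leq_trans (leq_pmull _ d_gt0).
    by rewrite -(leq_exp2l _ _ (isT : (1 < 2)%N)) (leq_trans le_N23).
  move: le_r; rewrite geq_max => /andP[le_N2 le_N3].
  have [||c [c_ok c_na agree]] := reduction_at_length r_gt0 le_n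
      (fun _ => le_dep) le_mod (nw_size_bound le_n le_d (S_ge r)) _
      (f_easy n le_N1) _ (dense _ le_N3) (OE _).
  - by case: (C) typC => //= a a_gt0; exact: nw_depth_bound.
  - exact: useful.
  exists c; split=> //.
    by apply: oracle_AC0_mono c_ok; exact: reduction_size_bound.
  by move=> _; apply: agreement_fraction agree => //; exact: ltnW.
(* The circuits are chosen length by length, and the approximating language is whatever they
   compute. *)
have [cs cs_ok] := choice red.
exists (fun x => Defs.eval O (cs (size x)) x); split.
  apply/near_ooP; exists N => n le_n; have [_ _ /(_ le_n)] := cs_ok n.
  rewrite card_tuple card_bool; congr (_ <= _%:R / _).
  by apply: eq_card => x; rewrite !inE size_tuple.
exists (Consts 5 0), (4 * d + 3)%N => n; have [c_ok c_na _] := cs_ok n.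
by exists (cs n); split=> // x; rewrite size_tuple.
Qed.

Lemma density_nat (P : property) : density_ge_quarter P ->
  exists N, forall l, (N <= l)%N ->
    (#|{: {ffun l.-tuple bool -> bool}}| <= 4 * #|P l|)%N.
Proof.
move=> /near_ooP[N dense]; exists N => l /dense.
rewrite ler_pdivlMr; last by rewrite ltr0n; apply/card_gt0P; exists [ffun=> false].
by rewrite mul1r -(ler_nat rat) natrM ler_pdivrMl.
Qed.

End Reals.

(** By counting, even half of all functions are hard. *)
Lemma density_hard C u (s : nat -> nat) :
  (forall l, s l ^ 2 <= 2 ^ l) ->
  exists N, forall l, N <= l ->
    #|{: {ffun l.-tuple bool -> bool}}| <=
      4 * #|[pred g : {ffun l.-tuple bool -> bool} | ~~ `[< has_circuit C u (s l) g >]]|.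
Proof.
move=> le_s; exists (maxn 14 (modulus_cap C u + 9)) => l; rewrite geq_max => /andP[le14 le_cap].
have := few_easy_functions le14 le_cap (le_s l).
set easy := [pred g | _]; set hard := [pred g | _].
have <- : #|{: {ffun l.-tuple bool -> bool}}| = 2 ^ 2 ^ l.
  by rewrite card_ffun card_tuple card_bool.
have <- : #|easy| + #|hard| = #|{: {ffun l.-tuple bool -> bool}}| := cardC easy.
by move: #|easy| #|hard| => a b; lia.
Qed.

(** A power of two determines its exponent. *)
Lemma slice_language (Q : nat -> seq bool -> Prop) l y : size y = 2 ^ l ->
  `[< exists n, size y = 2 ^ n /\ Q n y >] = `[< Q l y >].
Proof.
move=> sz_y; apply/asboolP/asboolP => [[n []]|Qy]; last by exists l.
by rewrite sz_y => /(expnI (isT : 1 < 2)) ->.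
Qed.


Theorem theorem7p4 (R : realType) (C : circuit_class) (p k : nat) (delta : R)
    (typC : typical C) (pr_p : prime p) (containsC : class_contains C (AC0p p))
    (k_ge1 : (1 <= k)%N) (delta_gt0 : (0 < delta)%R) (delta_lt1 : (delta < 1)%R) :
  exists (c : nat) (kappa : R), (0 < kappa <= 1 / 2)%R /\
    let eps := fun n : nat => (1 / 2 - kappa / n%:R ^+ c)%R in
    forall u : consts, exists u0 : consts, forall v : consts, le_consts u0 v ->
    forall f : language, in_class C u (fun n => n ^ k)%N f ->
      approx_tt_reduces AC0 eps f (MCSP C v (exp_size (1 / 2 : R)%R))
      /\ (forall P : property, density_ge_quarter P ->
            useful_against C v (exp_size delta) P ->
            approx_tt_reduces AC0 eps f (property_language P)).
Proof.
(* [d0] secures delta d >= k + 8 and the other term d/2 >= k + 8, so that one d, hence one exponent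
   c, serves both targets. *)
pose d0 := (Num.truncn ((k + 8)%:R / delta)%R).+1.
pose d := maxn d0 (2 * (k + 8)).
have le_delta : ((k + 8)%:R <= delta * d%:R)%R.
  rewrite mulrC -ler_pdivrMr // (le_trans (ltW (truncnS_gt _))) // ler_nat.
  exact: leq_maxl.
have le_half : ((k + 8)%:R <= 1 / 2 * d%:R :> R)%R.
  have : ((2 * (k + 8))%:R <= d%:R :> R)%R by rewrite ler_nat leq_maxr.
  by rewrite natrM; lra.
have d_gt0 : 0 < d by rewrite leq_max.
exists d, (1 / (4 * 2 ^+ d))%R; split.
  have : (1 <= 2 ^+ d :> R)%R by rewrite exprn_ege1 // ler1n.
  move=> le1; rewrite divr_gt0 ?mulr_gt0 ?exprn_gt0 //= ler_pdivrMr ?mulr_gt0 ?exprn_gt0 //.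
  by lra.
(* Nine more levels accommodate the address formulas; the moduli do not change. *)
move=> eps u; exists (Consts (depth_bound u + 9) (modulus_bound u)) => v.
move=> /andP[/= le_dep le_mod] f f_easy; split.
- pose s := exp_size (1 / 2 : R)%R.
  (* The hard functions: useful by definition and dense by counting. [MCSP] decides their complement
     on truth tables, hence the negated oracle. *)
  pose P : property := fun n =>
    [pred g : {ffun n.-tuple bool -> bool} | ~~ `[< has_circuit C v (s n) g >]].
  apply: (@property_reduction R C u v k d s f P _ true) => //.
  + by move=> r; exact: exp_size_ge.
  + by apply/near_ooP; exists 0 => n _ g; rewrite inE => /asboolP.
  + exact: (density_hard _ _ (@exp_size_half_sqr R)).
  + move=> l y sz_y; rewrite /MCSP.
    by rewrite (slice_language (fun n y => has_circuit C v (s n) (fn n y)) sz_y).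
- move=> P dense useful.
  apply: (@property_reduction R C u v k d (exp_size delta) f P _ false) => //.
  + by move=> r; exact: exp_size_ge.
  + exact: density_nat.
  + move=> l y sz_y; rewrite /property_language.
    by rewrite (slice_language (fun n y => fn n y \in P n) sz_y) asboolb.
Qed.
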